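(* Let $d\ge1$, let $P$ be a (hanging) rooted tree poset on $[d]=\{1,\dots,d\}$ and let $s\colon[d]\to\mathbb{N}$ be a map to the positive integers. Let $\ell\ge0$ and let $w\colon\mathbb{R}^d\to\mathbb{R}$ be given by $w(x)=w_1(x)\cdots w_\ell(x)$ (the empty product being $1$), where for each $i\in[\ell]$ the function $w_i$ is of one of the following forms: (i) $w_i(x)=\binom{x(k_i)+a_i}{b_i}$ for some $k_i\in[d]$ and integers $0\le a_i\le b_i$; (ii) $w_i(x)=\binom{\lfloor x(k_i)/s(k_i)\rfloor+a_i}{b_i}$ for some $k_i\in[d]$ and integers $0<a_i\le b_i$; (iii) $w_i(x)=\binom{\lceil x(k_i)/s(k_i)\rceil+a_i}{b_i}$ for some $k_i\in[d]$ and integers $0\le a_i<b_i$. Then the weighted $h^\ast$-polynomial of $\mathcal{O}(P,s)$ with respect to $w$ is real-rooted, i.e. all of its complex zeros are real.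
   Context: Here $x(k)$ denotes the $k$-th coordinate of $x$, and $\binom{y}{b}=y(y-1)\cdots(y-b+1)/b!$ for real $y$ and integer $b\ge0$. A (hanging) rooted tree on $[d]$ is a poset $P=([d],\preceq)$ whose Hasse diagram is a tree with the root at the top: there is a unique maximal element (the root), and every other element is covered by exactly one element. The labels in $[d]$ are arbitrary, i.e. they need not be compatible with $\preceq$. Let $P=([d],\preceq)$ be a poset on $[d]$ and $s\colon[d]\to\mathbb{N}$ a map to the positive integers. A map $f\colon[d]\to\mathbb{R}$ (identified with a vector in $\mathbb{R}^d$) is called a $(P,s)$-partition if $f(i)/s(i)\le f(j)/s(j)$ whenever $i\prec j$, and $f(i)/s(i)<f(j)/s(j)$ whenever $i\prec j$ and $i>j$ as integers. The $s$-lecture hall order polytope $\mathcal{O}(P,s)\subset\mathbb{R}^d$ is the (in general half-open) $d$-dimensional polytope of all $(P,s)$-partitions $f\in\mathbb{R}^d$ with $0\le f(i)/s(i)\le 1$ for all $i\in[d]$. For an integer $n\ge0$, its $n$-th dilate $n\mathcal{O}(P,s)$ is the set of all $(P,s)$-partitions $f\in\mathbb{R}^d$ with $0\le f(i)/s(i)\le n$ for all $i$. For $w$ as in the claim, the weighted Ehrhart function $\mathrm{E}_{\mathcal{O}(P,s)}(w;n)=\sum_{x\in n\mathcal{O}(P,s)\cap\mathbb{Z}^d}w(x)$, $n\ge 0$, is given by a polynomial in $n$ of degree $D=d+b_1+\cdots+b_\ell$. The weighted $h^\ast$-polynomial $h^\ast_w(t)$ of $\mathcal{O}(P,s)$ is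 the numerator of its generating function: $$\sum_{n\ge0}\mathrm{E}_{\mathcal{O}(P,s)}(w;n)\,t^n=\frac{h^\ast_w(t)}{(1-t)^{D+1}} .$$ *)

(* Defs.v *)
From HB Require Import structures.
From mathcomp Require Import all_boot all_order all_algebra.
From mathcomp Require Import complex.
From mathcomp Require Import boolp classical_sets functions cardinality fsbigop.
From mathcomp Require Import reals.

Set Implicit Arguments.
Unset Strict Implicit.
Unset Printing Implicit Defensive.

Import Order.TTheory GRing.Theory Num.Theory.
Local Open Scope classical_set_scope.
Local Open Scope ring_scope.

(* The ground set [d] = {1, .., d} is represented by 'I_d = {0, .., d-1}: only
   the order of the labels matters. A poset on [d] is a relation [P] on 'I_d,
   unrelated to the canonical (natural) order of 'I_d. *)
Section Posets.
Variables (d : nat) (P : rel 'I_d).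

Definition is_poset : Prop :=
  [/\ reflexive P, antisymmetric P & transitive P].

Definition strict (i j : 'I_d) : bool := (i != j) && P i j.

Definition covered_by (i j : 'I_d) : bool :=
  strict i j && [forall k, ~~ (strict i k && strict k j)].

Definition maximal (r : 'I_d) : Prop := forall j, ~~ strict r j.

Definition rooted_tree : Prop :=
  is_poset /\
  exists r, unique maximal r /\
            forall i, i != r -> exists! j, covered_by i j.

End Posets.

Section LectureHall.
Variables (R : realType) (d : nat) (P : rel 'I_d) (s : 'I_d -> nat).

Definition ratio (x : 'rV[R]_d) (i : 'I_d) : R := x 0 i / (s i)%:R.

Definition is_partition (x : 'rV[R]_d) : Prop :=
  forall i j : 'I_d, strict P i j ->
    ratio x i <= ratio x j /\ ((j < i)%N -> ratio x i < ratio x j).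

(* The [n]-th dilate of the s-lecture hall order polytope O(P, s), which is
   itself the case n = 1. *)
Definition lecture_hall_dilate (n : nat) : set 'rV[R]_d :=
  [set x | is_partition x /\ forall i, 0 <= ratio x i <= n%:R].

Definition integer_lattice : set 'rV[R]_d :=
  [set x | forall i, x 0 i \is a Num.int].

(* The sum ranges over a classical set, and would be 0 by convention if
   infinitely many terms were nonzero; [finite_lattice_points] below shows that
   this never happens for positive [s]. *)
Definition weighted_ehrhart (w : 'rV[R]_d -> R) (n : nat) : R :=
  \sum_(x \in lecture_hall_dilate n `&` integer_lattice) w x.

Definition real_binomial (y : R) (b : nat) : R :=
  (\prod_(i < b) (y - i%:R)) / b`!%:R.

(* [w] is a weight of one of the three allowed forms, with lower index [b]. *)
Definition weight_factor (w : 'rV[R]_d -> R) (b : nat) : Prop :=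
  exists (k : 'I_d) (a : nat),
    [\/ (a <= b)%N /\
          w = (fun x => real_binomial (x 0 k + a%:R) b),
        (0 < a <= b)%N /\
          w = (fun x => real_binomial ((Num.floor (ratio x k))%:~R + a%:R) b)
      | (a < b)%N /\
          w = (fun x => real_binomial ((Num.ceil (ratio x k))%:~R + a%:R) b)].

(* h is the polynomial such that, as formal power series in t,
   (1 - t)^(D+1) * \sum_(n >= 0) E(w; n) t^n = h(t);
   the left-hand side below is the k-th coefficient of the Cauchy product. *)
Definition is_weighted_hstar (w : 'rV[R]_d -> R) (D : nat) (h : {poly R}) :
    Prop :=
  forall k : nat,
    \sum_(j < k.+1) ((1 - 'X) ^+ D.+1 : {poly R})`_j
                    * weighted_ehrhart w (k - j) = h`_k.

Lemma is_weighted_hstar_unique w D h1 h2 :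
  is_weighted_hstar w D h1 -> is_weighted_hstar w D h2 -> h1 = h2.
Proof. by move=> H1 H2; apply/polyP => k; rewrite -H1 -H2. Qed.

Lemma finite_lattice_points n : (forall i, 0 < s i)%N ->
  finite_set (lecture_hall_dilate n `&` integer_lattice).
Proof.
move=> s0; pose m := \max_i (n * s i)%N.
apply: (@sub_finite_set _ _ ((fun f : {ffun 'I_d -> 'I_m.+1} =>
   \row_i (f i : nat)%:R : 'rV[R]_d) @` setT)); last first.
  by apply: finite_image; apply: finite_finset.
move=> x [[_ xn] xZ].
have xk i : exists k : 'I_m.+1, x 0 i = (k : nat)%:R.
  have si : 0 < (s i)%:R :> R by rewrite ltr0n.
  have /andP[x0 xle] := xn i.
  have {}x0 : 0 <= x 0 i by move: x0; rewrite /ratio pmulr_lge0 ?invr_gt0.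
  move: xle; rewrite /ratio ler_pdivrMr // -natrM.
  have /natrP[k xE] : x 0 i \is a Num.nat by rewrite natrEint xZ x0.
  rewrite xE ler_nat => kn.
  have km : (k < m.+1)%N.
    by rewrite ltnS (leq_trans kn) // (leq_bigmax (F := fun i => (n * s i)%N)).
  by exists (Ordinal km).
exists [ffun i => projT1 (cid (xk i))] => //.
by apply/rowP => i; rewrite mxE ffunE; case: cid.
Qed.

End LectureHall.

Definition real_rooted (R : realType) (p : {poly R}) : Prop :=
  forall z : R[i], root (map_poly (real_complex R) p) z -> z \is Num.real.

(* Main.v *)
(* Substitute x = 1 / (1 - t): a polynomial f of degree D in x encodes the
   sequence n |-> sum_a f_a C(n + a, a), whose generating function is x f(x) and
   whose h-polynomial is (1 - t)^D f(1 / (1 - t)). The h-polynomial has only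
   nonpositive zeros as soon as f has all its zeros in [0, 1].
   For a vertex v, the values W(n s(v) + j) with 0 <= j < s(v) fixed are encoded
   by polynomials f_j, and the invariant is that the f_j have all zeros in [0, 1]
   and interlace pairwise. It holds for the three kinds of weights, and it is
   preserved by prefix sums and by pointwise products (a refinement of Wagner's
   theorem on Hadamard products). Summing over the value at a leaf of the tree
   multiplies the weight of its parent by a prefix sum, so the leaves can be
   eliminated one by one until only the root is left.
   Interlacing is tested pointwise on the upper half plane, by requiring g(x) / f(x)
   to lie in the sector between 1 and (x - 1) / x = t. The relation is then convex
   in each argument, and nonvanishing of sums follows since the sector is smaller
   than a half plane. *)
Require Import Defs.
From mathcomp Require Import all_boot all_order all_algebra.
From mathcomp Require Import complex ring lra zify polyrcf.
From mathcomp Require Import boolp classical_sets functions cardinality fsbigop.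
From mathcomp Require Import reals.

Set Implicit Arguments.
Unset Strict Implicit.
Unset Printing Implicit Defensive.

Import Order.TTheory GRing.Theory Num.Theory.
Local Open Scope ring_scope.

(** * The sector relation *)

Section Sector.
Variable R : rcfType.
Implicit Types (s a b c x y : R[i]) (r : R).
Local Open Scope complex_scope.
Local Notation "z ^*" := (conjc z) : ring_scope.

(* For a <> 0: b / a is in the closed sector spanned by 1 and (s - 1) / s. *)
Definition sector s a b : Prop :=
  0 <= complex.Im (b * a^*) /\ 0 <= complex.Im ((s - 1) * a * (s * b)^*).

Lemma conjcM x y : (x * y)^* = x^* * y^*.
Proof. exact: rmorphM. Qed.

Lemma conjcD x y : (x + y)^* = x^* + y^*.
Proof. exact: rmorphD. Qed.

Lemma conjcN x : (- x)^* = - x^*.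
Proof. exact: rmorphN. Qed.

Lemma Im_realM r x : complex.Im (r%:C * x) = r * complex.Im x.
Proof. by case: x => u v /=; rewrite mul0r addr0. Qed.

Lemma mul_conj_real x : x * x^* = (complex.Re x ^+ 2 + complex.Im x ^+ 2)%:C.
Proof. by case: x => u v; simpc; congr (_ +i* _); ring. Qed.

Lemma sector_refl s a : 0 < complex.Im s -> sector s a a.
Proof.
move=> s0; split; first by rewrite mul_conj_real.
case: s a s0 => p q [u v] /= q0; suff : 0 <= q * (u ^+ 2 + v ^+ 2) by lra.
by apply: mulr_ge0; [exact: ltW|rewrite addr_ge0 ?sqr_ge0].
Qed.

Lemma sectorDr s a b c : sector s a b -> sector s a c -> sector s a (b + c).
Proof.
case=> h1 h2 [h3 h4]; split; first by rewrite mulrDl raddfD addr_ge0.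
by rewrite mulrDr conjcD mulrDr raddfD addr_ge0.
Qed.

Lemma sectorDl s a b c : sector s a c -> sector s b c -> sector s (a + b) c.
Proof.
case=> h1 h2 [h3 h4]; split; first by rewrite conjcD mulrDr raddfD addr_ge0.
by rewrite mulrDr mulrDl raddfD addr_ge0.
Qed.

Lemma sector0r s a : sector s a 0.
Proof. by split; rewrite !(mul0r, mulr0, conjc0). Qed.

Lemma sector0l s a : sector s 0 a.
Proof. by split; rewrite !(mul0r, mulr0, conjc0). Qed.

Lemma sectorZr s r a b : 0 <= r -> sector s a b -> sector s a (r%:C * b).
Proof.
move=> r0 [h1 h2]; split; first by rewrite -mulrA Im_realM mulr_ge0.
have -> : (s - 1) * a * (s * (r%:C * b))^* = r%:C * ((s - 1) * a * (s * b)^*).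
  by rewrite !conjcM conjc_real; ring.
by rewrite Im_realM mulr_ge0.
Qed.

Lemma sectorZl s r a b : 0 <= r -> sector s a b -> sector s (r%:C * a) b.
Proof.
move=> r0 [h1 h2]; split.
  have -> : b * (r%:C * a)^* = r%:C * (b * a^*).
    by rewrite conjcM conjc_real; ring.
  by rewrite Im_realM mulr_ge0.
have -> : (s - 1) * (r%:C * a) * (s * b)^* = r%:C * ((s - 1) * a * (s * b)^*).
  by ring.
by rewrite Im_realM mulr_ge0.
Qed.

Lemma Im_mul_conjM c x y : complex.Im ((c * x) * (c * y)^*) =
  (complex.Re c ^+ 2 + complex.Im c ^+ 2) * complex.Im (x * y^*).
Proof. by rewrite -Im_realM -mul_conj_real conjcM; congr complex.Im; ring. Qed.

Lemma sectorM s c a b : sector s a b -> sector s (c * a) (c * b).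
Proof.
case=> h1 h2; split; first by rewrite Im_mul_conjM mulr_ge0 // addr_ge0 ?sqr_ge0.
rewrite [_ * (c * a)]mulrCA [s * (c * b)]mulrCA Im_mul_conjM.
by rewrite mulr_ge0 // addr_ge0 ?sqr_ge0.
Qed.

Lemma sectorMI s c a b : c != 0 -> sector s (c * a) (c * b) -> sector s a b.
Proof.
by move=> c0 /(sectorM c^-1); rewrite !mulrA mulVf // !mul1r.
Qed.

(** With t = (s - 1) / s, the map z -> t / z exchanges the two boundary rays of the sector and
    therefore preserves it. *)
Lemma sector_turn s a b : sector s a b -> sector s (s * b) ((s - 1) * a).
Proof.
case=> h1 h2; split=> //.
have -> : (s - 1) * (s * b) * (s * ((s - 1) * a))^* =
  ((s - 1) * s * b) * ((s - 1) * s * a)^* by rewrite -!mulrA [(s - 1) * (s * a)]mulrCA.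
by rewrite Im_mul_conjM mulr_ge0 // addr_ge0 ?sqr_ge0.
Qed.

(** Since (s - 1) / s has positive imaginary part, the sector is narrower than a half plane and
    contains no two opposite nonzero points. *)
Lemma sector_opp s a b : 0 < complex.Im s -> a != 0 ->
  sector s a b -> sector s a (- b) -> b = 0.
Proof.
move=> s0 a0 [h1 h2] [h3 h4].
have {h1 h3} I0 : complex.Im (b * a^*) = 0.
  by apply/le_anti; rewrite h1 andbT -oppr_ge0 -raddfN -mulNr.
have {h2 h4} J0 : complex.Im ((s - 1) * a * (s * b)^*) = 0.
  apply/le_anti; rewrite h2 andbT -oppr_ge0 -raddfN.
  by move: h4; rewrite mulrN conjcN mulrN.
have abr : b * a^* = (complex.Re (b * a^*))%:C.
  by move: I0; case: (b * a^*) => u v /= ->.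
have : complex.Re (b * a^*) = 0.
  move: J0; have -> : (s - 1) * a * (s * b)^* =
      (complex.Re (b * a^*))%:C * ((s - 1) * s^*).
    have -> : ((complex.Re (b * a^*))%:C : R[i]) = (b * a^*)^*.
      by rewrite abr conjc_real.
    by rewrite !conjcM conjcK; ring.
  rewrite Im_realM; have -> : complex.Im ((s - 1) * s^*) = complex.Im s.
    by case: (s) => p q /=; ring.
  by move/eqP; rewrite mulf_eq0 (gt_eqF s0) orbF => /eqP.
rewrite abr => h; move: abr; rewrite h => /eqP.
by rewrite mulf_eq0 conjc_eq0 (negPf a0) orbF => /eqP.
Qed.

(** Otherwise both [a] and [- a] would lie in the sector of [a]. Sums are shown to be nonzero in
    this form. *)
Lemma sector_add_eq0 s a b : 0 < complex.Im s ->
  sector s a b -> a + b = 0 -> a = 0.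
Proof.
move=> s0 ab ab0; apply/eqP; case: (eqVneq a 0) => // a0.
have bE : b = - a by apply/eqP; rewrite -addr_eq0 addrC ab0.
have := sector_opp s0 a0 (sector_refl a s0); rewrite -bE => /(_ ab) a00.
by rewrite a00 eqxx in a0.
Qed.

Lemma Im_neq0 s : 0 < complex.Im s -> s != 0.
Proof. by move=> s0; apply/eqP=> s00; rewrite s00 ltxx in s0. Qed.

Lemma Im_subr s r : complex.Im (s - r%:C) = complex.Im s.
Proof. by case: s => p q /=; rewrite subr0. Qed.

(** [s - r] is the convex combination of [s] and [s - 1] with weights [1 - r] and [r], and [s - 1]
    lies on the far boundary ray of the sector of [s]. *)
Lemma sector_sub s r : 0 < complex.Im s -> 0 <= r <= 1 ->
  sector s s (s - r%:C) /\ sector s (s - r%:C) (s - 1).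
Proof.
move=> s0 /andP[r0 r1].
have -> : s - r%:C = (1 - r)%:C * s + r%:C * (s - 1) by rewrite rmorphB rmorph1; ring.
have h : sector s s (s - 1).
  by have := sector_turn (sector_refl 1 s0); rewrite !mulr1.
have r1' : 0 <= 1 - r by rewrite subr_ge0.
have ss := sector_refl s s0; have s1 := sector_refl (s - 1) s0.
by split; [apply: sectorDr; apply: sectorZr|apply: sectorDl; apply: sectorZl].
Qed.

End Sector.


(** * Coefficients of products of linear factors *)

Section LinearFactors.
Variable R : rcfType.
Implicit Types (s u : R[i]) (l : seq (R[i] * R[i])).

Definition lin_prod l : {poly R[i]} := \prod_(p <- l) (p.1 *: 'X + p.2%:P).

Lemma lin_prod_rem p l : p \in l ->
  lin_prod l = (p.1 *: 'X + p.2%:P) * lin_prod (rem p l).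
Proof. by move=> pl; rewrite /lin_prod (perm_big _ (perm_to_rem pl)) big_cons. Qed.

(** Euler's identity for the homogeneous form whose factors are a y + b z, taken at z = 1; the sum
    over [l] is the derivative in z. *)
Lemma lin_prod_euler l :
  \sum_(p <- l) p.2 *: lin_prod (rem p l) + 'X * (lin_prod l)^`() =
  lin_prod l *+ size l.
Proof.
elim: l => [|x l IH].
  by rewrite /lin_prod !big_nil derivC mulr0 addr0 mulr0n.
rewrite big_cons /= eqxx; have lE : lin_prod (x :: l) = (x.1 *: 'X + x.2%:P) * lin_prod l.
  by rewrite /lin_prod big_cons.
have -> : \sum_(p <- l) p.2 *: lin_prod (if x == p then l else x :: rem p l) =
    (x.1 *: 'X + x.2%:P) * \sum_(p <- l) p.2 *: lin_prod (rem p l).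
  rewrite mulr_sumr; apply: eq_big_seq => p pl; rewrite -scalerAr; congr (_ *: _).
  case: eqP => [->|_]; first by rewrite (lin_prod_rem pl).
  by rewrite /lin_prod big_cons.
rewrite lE derivM derivD derivZ derivX derivC addr0 mulrS -!mul_polyC.
rewrite -mulrnAr -IH; ring.
Qed.

Lemma size_lin_prod l : (size (lin_prod l) <= (size l).+1)%N.
Proof.
elim: l => [|x l IH]; first by rewrite /lin_prod big_nil size_poly1.
rewrite /lin_prod big_cons -/(lin_prod l) (leq_trans (size_polyMleq _ _)) //.
rewrite -ltnS -[(size (_ :: _)).+1]add2n.
have h : (size (x.1 *: 'X + x.2%:P)%R <= 2)%N.
  rewrite (leq_trans (size_polyD _ _)) // geq_max (leq_trans (size_scale_leq _ _)) ?size_polyX //.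
  by rewrite (leq_trans (size_polyC_leq1 _)).
by move: (leq_add h IH) => /=; case: (size _ + size _)%N => //=; rewrite ?add2n.
Qed.

Lemma coef_lin_prod_rem p l j : p \in l ->
  (lin_prod l)`_j.+1 =
    p.1 * (lin_prod (rem p l))`_j + p.2 * (lin_prod (rem p l))`_j.+1.
Proof.
by move=> pl; rewrite (lin_prod_rem pl) mulrDl coefD -scalerAl coefZ coefXM coefCM.
Qed.

(* Written for P = prod (a y + b), with P_p the product without the factor p,
   this rests on (n - j) P_j = sum_p b_p (P_p)_j together with
   P_(j+1) = a_p (P_p)_j + b_p (P_p)_(j+1). *)
Lemma lin_prod_sector s l : 0 < complex.Im s ->
  (forall p, p \in l -> [/\ p.1 != 0, p.2 != 0 & sector s (s * p.1) p.2]) ->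
  forall j, ((j <= size l)%N -> (lin_prod l)`_j != 0) /\
            sector s (s * (lin_prod l)`_j.+1) (lin_prod l)`_j.
Proof.
move=> s0; have [n] := ubnP (size l); elim: n l => // n IH l ln hl.
have hrem p : p \in l -> forall j,
    ((j <= (size l).-1)%N -> (lin_prod (rem p l))`_j != 0) /\
    sector s (s * (lin_prod (rem p l))`_j.+1) (lin_prod (rem p l))`_j.
  move=> pl; have := IH (rem p l); rewrite size_rem //; apply; last first.
    by move=> q /mem_rem; apply: hl.
  by case: (l) pl ln => [|x l'].
have sect j : sector s (s * (lin_prod l)`_j.+1) (lin_prod l)`_j.
  have [jl|lj] := ltnP j (size l); last first.
    rewrite [_`_j.+1]nth_default ?mulr0; first exact: sector0l.
    by rewrite (leq_trans (size_lin_prod l)).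
  have term p : p \in l ->
      sector s (s * (lin_prod l)`_j.+1) (p.2 * (lin_prod (rem p l))`_j).
    move=> pl; have [_ _ hp] := hl _ pl; have [_ hj] := hrem _ pl j.
    rewrite (coef_lin_prod_rem _ pl) mulrDr; apply: sectorDl.
      by rewrite mulrA ![_ * (lin_prod _)`_j]mulrC; apply: sectorM.
    by rewrite mulrCA; apply: sectorM.
  have := congr1 (fun q : {poly R[i]} => q`_j) (lin_prod_euler l).
  rewrite coefD coefMn coef_sum coefXM coef_deriv.
  have -> : (if j == 0 then 0 else (lin_prod l)`_j.-1.+1 *+ j.-1.+1) =
            (lin_prod l)`_j *+ j by case: (j).
  move/(congr1 (fun x => x - (lin_prod l)`_j *+ j)); rewrite addrK -mulrnBr 1?ltnW //.
  set S := \sum_(_ <- _) _ => SE.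
  have : sector s (s * (lin_prod l)`_j.+1) S.
    rewrite /S big_seq; apply: big_ind => [|x y|p /term]; first exact: sector0r.
      exact: sectorDr.
    by rewrite coefZ.
  (* [S] is [size l - j] times the coefficient, and [j < size l] makes that factor positive, so it
     can be divided out. *)
  rewrite SE -mulr_natl => /(@sectorZr _ s ((size l - j)%:R)^-1 _ _ _).
  rewrite invr_ge0 ler0n mulrA -(rmorph_nat (real_complex R)) -rmorphM.
  rewrite mulVf ?pnatr_eq0 -?lt0n ?subn_gt0 // rmorph1 mul1r; exact.
move=> j; split=> // jl; case: l ln hl hrem sect jl => [|p l] ln hl hrem sect.
  by rewrite leqn0 => /eqP->; rewrite /lin_prod big_nil coef1 eqxx oner_neq0.
have pl : p \in p :: l by rewrite mem_head.
have [p1 p2 hp] := hl _ pl.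
case: j => [_|j jl].
  have [/(_ isT) h0 _] := hrem _ pl 0%N.
  by rewrite (lin_prod_rem pl) mulrDl coefD -scalerAl coefZ coefXM coefCM mulr0 add0r mulf_neq0.
have [/(_ jl) hj0 hj] := hrem _ pl j.
rewrite (coef_lin_prod_rem _ pl) addrC; apply/negP => /eqP e0.
set a := (lin_prod (rem p (p :: l)))`_j.+1 in hj e0; set b := _`_j in hj e0 hj0.
have [a0|a0] := eqVneq a 0.
  by move/eqP: e0; rewrite a0 mulr0 add0r mulf_eq0 (negPf p1) (negPf hj0).
(* If the coefficient vanished, [p.1 * b] would be the opposite of [p.2 * a], with both in the
   sector of [s * (p.1 * a)]. *)
have h1 : sector s (s * (p.1 * a)) (p.2 * a).
  by rewrite mulrA ![_ * a]mulrC; apply: sectorM.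
have h2 : sector s (s * (p.1 * a)) (- (p.2 * a)).
  have -> : - (p.2 * a) = p.1 * b.
    by apply/eqP; rewrite eq_sym -addr_eq0 addrC; apply/eqP.
  by rewrite mulrCA; apply: sectorM.
have n0 : s * (p.1 * a) != 0 by rewrite !mulf_neq0 // Im_neq0.
by have /eqP := sector_opp s0 n0 h1 h2; rewrite mulf_eq0 (negPf p2) (negPf a0).
Qed.
End LinearFactors.


(** * Hadamard products *)

Section Diamond.
Variable R : rcfType.
Implicit Types (f g : {poly R}) (s : R[i]) (rs ps : seq R).
Local Open Scope complex_scope.

Definition cval s f : R[i] := (map_poly (real_complex R) f).[s].

Lemma cval0 s : cval s 0 = 0. Proof. by rewrite /cval rmorph0 horner0. Qed.
Lemma cvalD s f g : cval s (f + g) = cval s f + cval s g.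
Proof. by rewrite /cval rmorphD hornerD. Qed.
Lemma cvalM s f g : cval s (f * g) = cval s f * cval s g.
Proof. by rewrite /cval rmorphM hornerM. Qed.
Lemma cvalZ s c f : cval s (c *: f) = c%:C * cval s f.
Proof. by rewrite /cval map_polyZ hornerZ. Qed.
Lemma cvalX s : cval s 'X = s. Proof. by rewrite /cval map_polyX hornerX. Qed.
Lemma cvalXsubC s r : cval s ('X - r%:P) = s - r%:C.
Proof. by rewrite /cval rmorphB /= map_polyX map_polyC hornerXsubC. Qed.
Lemma cvalX1 s : cval s ('X - 1) = s - 1.
Proof. by rewrite -polyC1 cvalXsubC. Qed.
Lemma cval1 s : cval s 1 = 1. Proof. by rewrite /cval rmorph1 hornerC. Qed.
Lemma cval_sum s (I : Type) (r : seq I) (P : pred I) (F : I -> {poly R}) :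
  cval s (\sum_(i <- r | P i) F i) = \sum_(i <- r | P i) cval s (F i).
Proof. by elim/big_rec2: _ => [|i x y _ <-]; rewrite ?cval0 ?cvalD. Qed.
Lemma cvalXn s f n : cval s (f ^+ n) = cval s f ^+ n.
Proof. by rewrite /cval rmorphXn horner_exp. Qed.

Definition monic_roots rs : {poly R} := \prod_(r <- rs) ('X - r%:P).

Definition good D f : Prop := exists c rs,
  [/\ 0 < c, size rs = D, forall r, r \in rs -> 0 <= r <= 1 & f = c *: monic_roots rs].

Definition interlace f g : Prop :=
  forall s, 0 < complex.Im s -> sector s (cval s f) (cval s g).

(* The bilinear operation induced on f by pointwise multiplication of the
   sequences n |-> \sum_a f_a C(n + a, a). *)
Definition diamond f g : {poly R} :=
  \sum_(k < size f) f^`N(k) * g^`N(k) * ('X * ('X - 1)) ^+ k.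

Lemma diamond_wide n f g : (size f <= n)%N ->
  diamond f g = \sum_(k < n) f^`N(k) * g^`N(k) * ('X * ('X - 1)) ^+ k.
Proof.
move=> fn; rewrite /diamond (big_ord_widen n (fun k => f^`N(k) * g^`N(k) * ('X * ('X - 1)) ^+ k)) //.
rewrite big_mkcond; apply: eq_bigr => k _; case: ltnP => // h.
by rewrite nderivn_poly0 // !mul0r.
Qed.

Lemma diamondC f g : diamond f g = diamond g f.
Proof.
rewrite (@diamond_wide (maxn (size f) (size g)) f) ?leq_maxl //.
rewrite (@diamond_wide (maxn (size f) (size g)) g) ?leq_maxr //.
by apply: eq_bigr => k _; rewrite [f^`N(k) * _]mulrC.
Qed.

Lemma diamondDr f g h : diamond f (g + h) = diamond f g + diamond f h.
Proof.
by rewrite -big_split; apply: eq_bigr => k _; rewrite raddfD /= mulrDr mulrDl.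
Qed.

Lemma diamondZr c f g : diamond f (c *: g) = c *: diamond f g.
Proof.
by rewrite scaler_sumr; apply: eq_bigr => k _; rewrite linearZ /= -scalerAr -scalerAl.
Qed.

Lemma diamondDl f g h : diamond (f + g) h = diamond f h + diamond g h.
Proof. by rewrite !(diamondC _ h) diamondDr. Qed.

Lemma diamondZl c f g : diamond (c *: f) g = c *: diamond f g.
Proof. by rewrite !(diamondC _ g) diamondZr. Qed.

Lemma nderivnS_XsubC_mul r f k :
  (('X - r%:P) * f)^`N(k.+1) = ('X - r%:P) * f^`N(k.+1) + f^`N(k).
Proof.
have -> : ('X - r%:P) * f = f * 'X + 0%:P - r *: f.
  by rewrite polyC0 addr0 mulrBl mul_polyC mulrC.
by rewrite raddfB /= nderivnMXaddC linearZ /= -mul_polyC; ring.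
Qed.

(** In an auxiliary variable y, these are the factors of f(s + y), and the next definition gives
    those of y^n g(s + s (s - 1) / y) for g with n zeros. The second product lists the scaled Taylor
    coefficients of g in reverse order. *)
Definition taylor_factors s rs := [seq (1 : R[i], s - r%:C) | r <- rs].
Definition rev_taylor_factors s rs := [seq (s - r%:C, s * (s - 1)) | r <- rs].

Lemma coef_taylor_factors s rs k :
  (lin_prod (taylor_factors s rs))`_k = cval s (monic_roots rs)^`N(k).
Proof.
elim: rs k => [|r rs IH] k; rewrite /lin_prod /monic_roots.
  rewrite !big_nil; case: k => [|k]; first by rewrite nderivn0 cval1 coef1.
  by rewrite coef1 nderivnC /= cval0.
rewrite !big_cons -/(lin_prod _) -/(monic_roots rs) scale1r mulrDl coefD coefXM coefCM.
case: k => [|k] /=; first by rewrite add0r IH !nderivn0 cvalM cvalXsubC.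
by rewrite !IH nderivnS_XsubC_mul cvalD cvalM cvalXsubC addrC.
Qed.

Lemma coef_rev_taylor_factors s ps k : (k <= size ps)%N ->
  (lin_prod (rev_taylor_factors s ps))`_(size ps - k) =
  cval s (monic_roots ps)^`N(k) * (s * (s - 1)) ^+ k.
Proof.
elim: ps k => [|r ps IH] k; rewrite /lin_prod /monic_roots.
  by rewrite leqn0 => /eqP->; rewrite !big_nil /= nderivn0 cval1 coef1 mul1r.
rewrite !big_cons -/(lin_prod _) -/(monic_roots ps) mulrDl coefD.
rewrite -scalerAl coefZ coefXM coefCM /=.
case: k => [|k] kp /=.
  rewrite subn0 /= nderivn0 -[size ps]subn0 IH // nderivn0 subn0 cvalM cvalXsubC.
  rewrite [_`_(size ps).+1]nth_default ?mulr0 ?addr0 ?mulr1 //.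
  by rewrite (leq_trans (size_lin_prod _)) ?size_map.
rewrite subSS nderivnS_XsubC_mul cvalD cvalM cvalXsubC [RHS]mulrDl exprS.
congr (_ + _); last by rewrite IH //; ring.
move: kp; rewrite ltnS leq_eqVlt => /orP[/eqP-> | kp].
  rewrite subnn /= mulr0 nderivn_poly0 ?cval0 ?mulr0 ?mul0r //.
  by rewrite size_prod_XsubC.
rewrite subn_eq0 leqNgt kp /= -subnS IH // exprS; ring.
Qed.

(** The sum defining [diamond] is the Cauchy product of the Taylor coefficients of one polynomial
    with the reversed, scaled ones of the other. It is thus a single coefficient of a product of
    linear factors, to which [lin_prod_sector] applies. *)
Lemma cval_diamond s rs ps :
  cval s (diamond (monic_roots rs) (monic_roots ps)) =
  (lin_prod (taylor_factors s rs ++ rev_taylor_factors s ps))`_(size ps).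
Proof.
rewrite /lin_prod big_cat /= -!/(lin_prod _) coefM diamondC /diamond cval_sum.
rewrite size_prod_XsubC; apply: eq_bigr => -[k /= kp] _.
rewrite coef_taylor_factors coef_rev_taylor_factors // !cvalM cvalXn cvalM cvalX cvalX1.
ring.
Qed.

Lemma taylor_factors_sector s rs ps : 0 < complex.Im s ->
  (forall r, r \in rs -> 0 <= r <= 1) -> (forall r, r \in ps -> 0 <= r <= 1) ->
  forall p, p \in taylor_factors s rs ++ rev_taylor_factors s ps ->
    [/\ p.1 != 0, p.2 != 0 & sector s (s * p.1) p.2].
Proof.
move=> s0 hrs hps p; have sr r : s - r%:C != 0 by rewrite Im_neq0 // Im_subr.
rewrite mem_cat => /orP[/mapP[r /hrs r01 ->]|/mapP[r /hps r01 ->]] /=.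
  by rewrite oner_neq0 mulr1; split=> //; apply: (sector_sub s0 r01).1.
split=> //; first by rewrite mulf_neq0 ?Im_neq0 // -[1]/((1 : R)%:C) Im_subr.
by apply: sectorM; apply: (sector_sub s0 r01).2.
Qed.

Lemma cval_diamond_neq0 p q f g s : good p f -> good q g ->
  0 < complex.Im s -> cval s (diamond f g) != 0.
Proof.
move=> [c [rs [c0 _ hrs ->]]] [d [ps [d0 _ hps ->]]] s0.
rewrite diamondZl diamondZr !cvalZ !mulf_neq0 //.
- by rewrite (inj_eq (@complexI R)) gt_eqF.
- by rewrite (inj_eq (@complexI R)) gt_eqF.
rewrite cval_diamond; have [h _] := lin_prod_sector s0 (taylor_factors_sector s0 hrs hps) (size ps).
by apply: h; rewrite size_cat !size_map leq_addl.
Qed.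

(** An extra zero in the second argument contributes one linear factor. Both values are therefore
    combinations of the same two neighbouring coefficients of [P], whose sector relation is
    known. *)
Lemma diamond_interlace_move p q f g : good p f -> good q g ->
  interlace (diamond f ('X * g)) (diamond f (('X - 1) * g)).
Proof.
move=> [c [rs [c0 _ hrs ->]]] [d [ps [d0 _ hps ->]]] s s0.
have E r : ('X - r%:P) * (d *: monic_roots ps) = d *: monic_roots (r :: ps).
  by rewrite -scalerAr /monic_roots big_cons.
have X0 : 'X = 'X - 0%:P :> {poly R} by rewrite subr0.
rewrite {1}X0 -polyC1 !E !(diamondZl, diamondZr) !cvalZ.
do 2!(apply: sectorM); rewrite !cval_diamond /=.
set P := lin_prod (taylor_factors s rs ++ rev_taylor_factors s ps).
have PE r : (lin_prod (taylor_factors s rs ++ rev_taylor_factors s (r :: ps)))`_(size ps).+1 =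
    (s - r%:C) * P`_(size ps) + s * (s - 1) * P`_(size ps).+1.
  rewrite /P /lin_prod !big_cat /= big_cons /= mulrCA mulrDl coefD -scalerAl.
  by rewrite coefZ coefXM coefCM.
have [_ hP] := lin_prod_sector s0 (taylor_factors_sector s0 hrs hps) (size ps).
rewrite !PE rmorph0 rmorph1 subr0; apply: sectorDl; apply: sectorDr.
- exact: sector_turn (sector_refl _ s0).
- by have := sector_turn hP; rewrite mulrCA mulrA.
- by rewrite [s * (s - 1)]mulrC -mulrA; apply: sectorM.
exact: sector_refl.
Qed.

End Diamond.


(** * Partial fractions of interlacing pairs *)

Section Cone.
Variable R : rcfType.
Implicit Types (f g q : {poly R}) (s u w : R[i]) (rs : seq R) (r x : R).
Local Open Scope complex_scope.

Lemma monic_roots_perm rs rs' : perm_eq rs rs' -> monic_roots rs = monic_roots rs'.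
Proof. exact: perm_big. Qed.

Lemma monic_roots_rem r rs : r \in rs ->
  monic_roots rs = ('X - r%:P) * monic_roots (rem r rs).
Proof.
by move=> rrs; rewrite (monic_roots_perm (perm_to_rem rrs)) /monic_roots big_cons.
Qed.

Lemma monic_roots_ge0 rs x : (forall r, r \in rs -> r <= x) -> 0 <= (monic_roots rs).[x].
Proof.
move=> h; rewrite /monic_roots horner_prod big_seq; apply: prodr_ge0 => r /h.
by rewrite hornerXsubC subr_ge0.
Qed.

Lemma cval_conj s f : cval (conjc s) f = conjc (cval s f).
Proof.
rewrite /cval -horner_map -map_poly_comp; congr (_.[_]).
by apply: eq_map_poly => x; rewrite /= oppr0.
Qed.

Lemma cval_real x f : cval x%:C f = (f.[x])%:C.
Proof. by rewrite /cval horner_map. Qed.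

(** Conjugation symmetry excludes zeros in the lower half plane as well, so all zeros are real; the
    signs for x > 1 and x < 0 then confine them to [0, 1]. *)
Lemma goodI D f : (size f <= D.+1)%N -> 0 < f`_D ->
  (forall s, 0 < complex.Im s -> cval s f != 0) ->
  (forall x, 1 < x -> 0 < f.[x]) ->
  (forall x, x < 0 -> 0 < (-1) ^+ D * f.[x]) -> good D f.
Proof.
move=> sf fD hs h1 h0.
have szf : size f = D.+1.
  by apply/anti_leq; rewrite sf ltnNge; apply: contraTN fD => /leq_sizeP->; rewrite ?ltxx.
have [zs zsE] := closed_field_poly_normal (map_poly (real_complex R) f).
have lf : lead_coef (map_poly (real_complex R) f) = (f`_D)%:C.
  by rewrite lead_coef_map /lead_coef szf.
have f0 : (f`_D)%:C != 0 :> R[i] by rewrite (inj_eq (@complexI R)) gt_eqF.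
have rt z : z \in zs -> cval z f = 0.
  move=> zz; rewrite /cval zsE hornerZ horner_prod (big_rem z) //= hornerXsubC subrr.
  by rewrite mul0r mulr0.
have zre z : z \in zs -> z = (complex.Re z)%:C.
  move=> zz; have : complex.Im z = 0; last by case: (z) => a b /= ->.
  have := rt z zz; have [hz|hz|//] := ltgtP (complex.Im z) 0 => fz.
    have /hs : 0 < complex.Im (conjc z) by case: (z) hz => a b /=; rewrite oppr_gt0.
    by rewrite cval_conj fz conjc0 eqxx.
  by have := hs _ hz; rewrite fz eqxx.
exists f`_D, [seq complex.Re z | z <- zs]; split=> //.
- have /(congr1 (fun p : {poly R[i]} => size p)) := zsE.
  by rewrite size_map_poly szf lf size_scale // size_prod_XsubC size_map => -[].
- move=> r /mapP[z zz ->]; have := rt z zz; rewrite (zre z zz) cval_real => /complexI fz.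
  rewrite /= !leNgt; apply/andP; split; apply/negP.
    by move/h0; rewrite fz mulr0 ltxx.
  by move/h1; rewrite fz ltxx.
apply: (map_poly_inj (real_complex R)); rewrite zsE map_polyZ lf; congr (_ *: _).
rewrite /monic_roots big_map rmorph_prod big_seq [RHS]big_seq; apply: eq_bigr => z zz.
by rewrite rmorphB /= map_polyX map_polyC /= -zre.
Qed.

Section GoodFacts.
Variables (D : nat) (f : {poly R}) (gf : good D f).

Lemma good_size : size f = D.+1.
Proof.
have [c [rs [c0 <- _ ->]]] := gf.
by rewrite size_scale ?gt_eqF // size_prod_XsubC.
Qed.

Lemma good_lead : 0 < f`_D.
Proof.
have := good_size; have [c [rs [c0 <- _ ->]]] := gf => sz.
have /monicP : monic_roots rs \is monic by apply: monic_prod => r _; rewrite monicXsubC.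
by rewrite coefZ /lead_coef size_prod_XsubC => ->; rewrite mulr1.
Qed.

Lemma good_neq0 s : 0 < complex.Im s -> cval s f != 0.
Proof.
have [c [rs [c0 _ _ ->]]] := gf => s0.
rewrite cvalZ mulf_neq0 //; first by rewrite (inj_eq (@complexI R)) gt_eqF.
rewrite /monic_roots; elim: rs => [|r rs IH]; first by rewrite big_nil cval1 oner_neq0.
by rewrite big_cons cvalM mulf_neq0 // cvalXsubC Im_neq0 // Im_subr.
Qed.

Lemma good_gt1 x : 1 < x -> 0 < f.[x].
Proof.
have [c [rs [c0 _ hr ->]]] := gf => x1; rewrite hornerZ mulr_gt0 //.
rewrite /monic_roots horner_prod big_seq; apply: prodr_gt0 => r /hr /andP[_ r1].
by rewrite hornerXsubC subr_gt0 (le_lt_trans r1).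
Qed.

Lemma good_lt0 x : x < 0 -> 0 < (-1) ^+ D * f.[x].
Proof.
have [c [rs [c0 <- hr ->]]] := gf => x1; rewrite hornerZ mulrCA mulr_gt0 //.
rewrite /monic_roots horner_prod; elim: rs hr => [|r rs IH] hr.
  by rewrite big_nil mulr1 ltr01.
rewrite big_cons exprS mulrACA mulr_gt0 //.
  have /andP[r0 _] := hr r (mem_head _ _).
  by rewrite hornerXsubC mulN1r opprB subr_gt0 (lt_le_trans x1).
by apply: IH => y yr; apply: hr; rewrite in_cons yr orbT.
Qed.

End GoodFacts.

Lemma poly_ge0_right x (G : {poly R}) : (forall e, x < e -> 0 <= G.[e]) -> 0 <= G.[x].
Proof.
move=> h; rewrite leNgt; apply/negP => G0.
have [|d d0 hd] := @poly_cont _ x G (- G.[x]); first by rewrite oppr_gt0.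
have d2 : 0 < d / 2 by rewrite divr_gt0.
have := hd (x + d / 2); rewrite addrAC subrr add0r gtr0_norm // ltr_pdivrMr //.
rewrite ltr_pMr // ltr1n => /(_ isT).
have := h (x + d / 2); rewrite ltrDl => /(_ d2); move: (G.[_ + _]) => y y0.
by rewrite ltr_norml => /andP[_]; rewrite ltrBlDr addNr ltNge y0.
Qed.

(** Turns an imaginary part along the real axis into a real polynomial, so that limits reduce to
    continuity of real polynomials. *)
Lemma horner_Im (K : {poly R[i]}) x :
  (\poly_(i < size K) complex.Im K`_i).[x] = complex.Im K.[x%:C].
Proof.
rewrite horner_poly horner_coef raddf_sum; apply: eq_bigr => i _ /=.
by rewrite -rmorphXn [K`_i * _]mulrC Im_realM mulrC.
Qed.

(** Approach [r] along the ray r + e u. After division by e^m, the product of g with the conjugate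
    of f tends to conj(u)^m g(r) q(r), and its imaginary part is nonnegative for every e > 0. *)
Lemma interlace_local f g q r m : f = ('X - r%:P) ^+ m * q -> interlace f g ->
  forall u, 0 < complex.Im u -> 0 <= complex.Im (conjc u ^+ m) * (g.[r] * q.[r]).
Proof.
move=> fE fg u u0; pose arg v : {poly R[i]} := r%:C%:P + v *: 'X.
pose K := (map_poly (real_complex R) g \Po arg u) *
  (map_poly (real_complex R) q \Po arg (conjc u)) * (conjc u ^+ m)%:P.
have KE e : K.[e%:C] = cval (r%:C + u * e%:C) g * cval (r%:C + conjc u * e%:C) q * conjc u ^+ m.
  by rewrite /K !hornerE !horner_comp /arg !hornerE.
have : 0 <= (\poly_(i < size K) complex.Im K`_i).[0].
  apply: poly_ge0_right => e e0; rewrite horner_Im KE.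
  have I0 : 0 < complex.Im (r%:C + u * e%:C).
    by case: (u) u0 => a b /= b0; rewrite mulr0 !add0r mulr_gt0.
  have [+ _] := fg _ I0.
  have cE : conjc (r%:C + u * e%:C) = r%:C + conjc u * e%:C.
    by rewrite conjcD conjcM !conjc_real.
  rewrite -cval_conj cE fE cvalM cvalXn cvalXsubC addrAC subrr add0r exprMn.
  set a := cval _ g; set b := cval _ q; set v := conjc u ^+ m.
  have -> : a * (v * e%:C ^+ m * b) = (e ^+ m)%:C * (a * b * v).
    by rewrite [in RHS]rmorphXn; ring.
  by rewrite Im_realM pmulr_rge0 // exprn_gt0.
rewrite horner_Im KE !mulr0 !addr0 !cval_real -rmorphM Im_realM mulrC.
by [].
Qed.

(** The m-th roots of [w] sum to zero and none of them is real, so they cannot all lie in the lower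
    half plane. *)
Lemma exists_root_upper m w : (1 < m)%N -> complex.Im w != 0 ->
  exists2 u, 0 < complex.Im u & u ^+ m = w.
Proof.
move=> m1 w0; have m0 : (0 < m)%N by apply: ltnW.
have [zs zsE] := closed_field_poly_normal ('X^m - w%:P).
move: zsE; rewrite lead_coefXnsubC // scale1r => zsE.
have szs : size zs = m.
  have /(congr1 (fun p : {poly R[i]} => size p)) := zsE.
  by rewrite size_XnsubC // size_prod_XsubC => -[].
have rt z : z \in zs -> z ^+ m = w.
  move=> zz; have : root ('X^m - w%:P) z by rewrite zsE root_prod_XsubC.
  by rewrite rootE !hornerE subr_eq0 => /eqP.
have sum0 : \sum_(z <- zs) z = 0.
  have := coefPn_prod_XsubC; move/(_ R[i] zs); rewrite szs -lt0n => /(_ m0).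
  rewrite -zsE coefB coefXn coefC; move: m1; case: (m) => [|[|k]] //= _.
  by rewrite ltn_eqF //= subr0 => /eqP; rewrite eq_sym oppr_eq0 => /eqP.
case: (boolP (has (fun z => 0 < complex.Im z) zs)) => [/hasP[u uz u0]|].
  by exists u => //; apply: rt.
move/hasPn => hz; exfalso.
have hlt z : z \in zs -> complex.Im z < 0.
  move=> zz; rewrite lt_neqAle leNgt hz // andbT; apply: contra w0 => z0.
  have zr : z = (complex.Re z)%:C by case: (z) z0 => a b /= /eqP->.
  by rewrite -(rt z zz) zr -rmorphXn.
have : complex.Im (\sum_(z <- zs) z) < 0.
  case: zs {zsE rt hz sum0} szs hlt => [|z zs] szs hlt; first by rewrite -szs in m0.
  have h0 := hlt z (mem_head _ _).
  have hs : complex.Im (\sum_(y <- zs) y) <= 0.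
    rewrite raddf_sum big_seq; apply: sumr_le0 => y yz; apply: ltW; apply: hlt.
    by rewrite in_cons yz orbT.
  by rewrite big_cons raddfD /=; lra.
by rewrite sum0 ltxx.
Qed.

(** Directions u with u^m = i and with u^m = -i impose opposite signs on the same real number. *)
Lemma interlace_multiple_root f g q r m : (1 < m)%N ->
  f = ('X - r%:P) ^+ m * q -> interlace f g -> g.[r] * q.[r] = 0.
Proof.
move=> m1 fE fg; have h := interlace_local fE fg.
have [|u u0 uE] := @exists_root_upper m (0 +i* 1) m1; first by rewrite /= oner_neq0.
have [|v v0 vE] := @exists_root_upper m (0 -i* 1) m1.
  by rewrite /= oppr_eq0 oner_neq0.
have := h u u0; have := h v v0.
have cX (z : R[i]) : conjc z ^+ m = conjc (z ^+ m).
  exact: esym (rmorphXn _ _ _).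
rewrite !cX uE vE /= opprK mul1r mulN1r oppr_ge0 => h1 h2.
by apply/le_anti; rewrite h1 h2.
Qed.

(** The direction u = i with m = 1; when q(r) is nonzero, this is the sign of the residue of g / f
    at [r]. *)
Lemma interlace_residue f g q r : f = ('X - r%:P) * q -> interlace f g ->
  g.[r] * q.[r] <= 0.
Proof.
move=> fE fg; have := @interlace_local f g q r 1; rewrite expr1 => /(_ fE fg (0 +i* 1)).
by rewrite expr1 /= ltr01 mulN1r oppr_ge0 => /(_ isT).
Qed.

End Cone.


(** * Hadamard products preserve interlacing *)

Section Product.
Variable R : rcfType.
Implicit Types (f g q : {poly R}) (s u w : R[i]) (rs : seq R) (r x : R).
Local Open Scope complex_scope.

Lemma interlace_simple_root c rs g r : c != 0 -> interlace (c *: monic_roots rs) g ->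
  ~~ root g r -> r \in rs -> r \notin rem r rs.
Proof.
move=> c0 fg gr rrs; apply/negP => rr; set f := c *: _ in fg.
have fE : f = ('X - r%:P) * (('X - r%:P) * (c *: monic_roots (rem r (rem r rs)))).
  by rewrite /f (monic_roots_rem rrs) (monic_roots_rem rr) -!scalerAr.
have f0 : f != 0 by rewrite scaler_eq0 (negPf c0) monic_neq0 // monic_prod_XsubC.
have [m [q]] := multiplicity_XsubC f r; rewrite f0 /= mulrC => qr qE.
case: m qE => [|[|m]] qE.
- by move: qr; rewrite -[q]mul1r -(expr0 ('X - r%:P)) -qE fE rootM root_XsubC eqxx.
- have X0 : 'X - r%:P != 0 :> {poly R} by rewrite polyXsubC_eq0.
  by move: qr; move: qE; rewrite fE expr1 => /(mulfI X0) <-; rewrite rootM root_XsubC eqxx.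
have := interlace_multiple_root (isT : (1 < m.+2)%N) qE fg => /eqP.
by rewrite mulf_eq0 -!/(root _ _) (negPf gr) (negPf qr).
Qed.

Lemma uniq_rem_notin (T : eqType) (l : seq T) :
  (forall y : T, y \in l -> y \notin rem y l) -> uniq l.
Proof.
elim: l => //= z l IH h; have zl : z \notin l by have := h z (mem_head _ _); rewrite eqxx.
rewrite zl; apply: IH => y yl; have := h y; rewrite in_cons yl orbT => /(_ isT).
by case: eqP => [zy|_]; [rewrite zy yl in zl|rewrite in_cons negb_or => /andP[]].
Qed.

(* The quotient of two interlacing polynomials is a Nevanlinna function, so its
   partial fraction expansion has nonnegative coefficients. *)
Lemma interlace_cone (Q : {poly R} -> Prop) c rs g : 0 < c ->
  (forall r, r \in rs -> 0 <= r <= 1) ->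
  interlace (c *: monic_roots rs) g -> (size g <= (size rs).+1)%N ->
  (forall x, 1 < x -> 0 <= g.[x]) ->
  (forall p q, Q p -> Q q -> Q (p + q)) -> (forall a p, 0 <= a -> Q p -> Q (a *: p)) ->
  Q (c *: monic_roots rs) ->
  (forall r, r \in rs -> Q (('X - 1) * (c *: monic_roots (rem r rs)))) -> Q g.
Proof.
move=> c0; have [n] := ubnP (size rs); elim: n => // n IH in Q rs g *.
move=> szn hrs fg szg g1 QD QZ Qf QF.
(* A common zero is divided out of both polynomials, and the cone [Q] is pulled back along
   multiplication by X - r. *)
case: (boolP (has (root g) rs)) => [/hasP[r rrs /factor_theorem[g' gE]]|/hasPn nroot].
  have fE : c *: monic_roots rs = ('X - r%:P) * (c *: monic_roots (rem r rs)).
    by rewrite (monic_roots_rem rrs) scalerAr.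
  have sr : (size (rem r rs)).+1 = size rs.
    by rewrite size_rem // prednK // lt0n size_eq0; case: (rs) rrs.
  rewrite mulrC in gE; rewrite gE; pose Q' p := Q (('X - r%:P) * p).
  apply: (IH Q' (rem r rs) g').
  - by rewrite sr -ltnS.
  - by move=> y /mem_rem /hrs.
  - move=> s s0; have := fg s s0; rewrite fE gE !cvalM; apply: sectorMI.
    by rewrite cvalXsubC Im_neq0 // Im_subr.
  - rewrite sr; case: (eqVneq g' 0) => [->|g'0]; first by rewrite size_poly0.
    by move: szg; rewrite gE size_monicM ?monicXsubC // size_XsubC.
  - move=> x x1; have := g1 x x1; rewrite gE hornerM hornerXsubC pmulr_rge0 //.
    by rewrite subr_gt0 (le_lt_trans _ x1) //; have /andP[] := hrs _ rrs.
  - by move=> p q hp hq; rewrite /Q' mulrDr; apply: QD.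
  - by move=> a p a0 hp; rewrite /Q' -scalerAr; apply: QZ.
  - by rewrite /Q' -fE.
  move=> y yr; have yrs := mem_rem yr.
  have -> : Q' (('X - 1) * (c *: monic_roots (rem y (rem r rs)))) =
            Q (('X - 1) * (c *: monic_roots (rem y rs))).
    rewrite /Q' mulrCA -scalerAr; congr (Q (_ * (c *: _))).
    have X0 : 'X - y%:P != 0 :> {poly R} by rewrite polyXsubC_eq0.
    by apply: (mulfI X0); rewrite mulrCA -!monic_roots_rem.
  exact: QF.
(* Without common zeros, every zero of the first polynomial is simple. *)
have urs : uniq rs.
  apply: uniq_rem_notin => r rrs.
  exact: interlace_simple_root (lt0r_neq0 c0) fg (nroot _ rrs) rrs.
pose F r := c *: monic_roots (rem r rs).
have fE r : r \in rs -> c *: monic_roots rs = ('X - r%:P) * F r.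
  by move=> rrs; rewrite (monic_roots_rem rrs) scalerAr.
have Fr r : r \in rs -> (F r).[r] != 0.
  move=> rrs; rewrite hornerZ mulf_eq0 gt_eqF //= -/(root _ _) root_prod_XsubC.
  by rewrite mem_rem_uniqF.
have res r : r \in rs -> g.[r] * (F r).[r] <= 0.
  by move=> rrs; apply: interlace_residue fg; apply: fE.
have g1' : 0 <= g.[1] by apply: poly_ge0_right.
(* If 1 were in [rs], then [(F 1).[1] > 0], and the residue sign together with [g1'] would make 1 a
   zero of [g] too. *)
have n1 : 1 \notin rs.
  apply/negP => rrs; have F1 : 0 < (F 1).[1].
    rewrite lt_neqAle eq_sym Fr // hornerZ; apply: mulr_ge0; first exact: ltW.
    by apply: monic_roots_ge0 => r /mem_rem /hrs /andP[].
  have := res _ rrs; rewrite pmulr_lle0 // => g1l.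
  by have := nroot _ rrs; rewrite rootE eq_le g1l g1'.
have f1 : 0 < (c *: monic_roots rs).[1].
  rewrite lt_neqAle eq_sym -/(root _ _) rootZ ?gt_eqF // root_prod_XsubC n1 /=.
  rewrite hornerZ; apply: mulr_ge0; first exact: ltW.
  by apply: monic_roots_ge0 => r /hrs /andP[].
(* The Lagrange coefficient at [r]: all other terms of [p] below vanish there. *)
pose a r := g.[r] / ((r - 1) * (F r).[r]).
have a0 r : r \in rs -> 0 <= a r.
  move=> rrs; have r1 : r < 1.
    have /andP[_] := hrs _ rrs; rewrite le_eqVlt => /orP[/eqP r1|//].
    by rewrite -r1 rrs in n1.
  have -> : a r = (g.[r] * (F r).[r]) * ((r - 1)^-1 * ((F r).[r] ^+ 2)^-1).
    by rewrite /a; field; rewrite Fr // subr_eq0 lt_eqF.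
  apply: mulr_le0; first exact: res.
  apply: mulr_le0_ge0; last by rewrite invr_ge0 sqr_ge0.
  by rewrite invr_le0 subr_le0 ltW.
pose p := g.[1] / (c *: monic_roots rs).[1] *: (c *: monic_roots rs) +
  \sum_(r <- rs) a r *: (('X - 1) * F r).
suff -> : g = p.
  apply: (QD); first by apply: (QZ) => //; rewrite divr_ge0 // ltW.
  rewrite big_seq; apply: big_ind => [||r rrs]; last by apply: (QZ); [exact: a0|exact: QF].
    by rewrite -(scale0r (c *: monic_roots rs)); apply: (QZ).
  by move=> *; apply: (QD).
have pE x : p.[x] = g.[1] / (c *: monic_roots rs).[1] * (c *: monic_roots rs).[x] +
    \sum_(r <- rs) a r * ((x - 1) * (F r).[x]).
  rewrite /p hornerD [in LHS]hornerZ horner_sum; congr (_ + _); apply: eq_bigr => r _.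
  by rewrite hornerZ hornerM -polyC1 hornerXsubC.
apply/eqP; rewrite -subr_eq0; apply/eqP.
(* Both sides have size at most [size rs + 1] and agree at the [size rs + 1] distinct points 1 and
   [rs]. *)
apply: (@roots_geq_poly_eq0 _ _ (1 :: rs)); last first.
- rewrite (leq_trans (size_polyD _ _)) // geq_max szg size_polyN.
  rewrite (leq_trans (size_polyD _ _)) // geq_max; apply/andP; split.
    by rewrite !(leq_trans (size_scale_leq _ _)) // size_prod_XsubC.
  rewrite (leq_trans (size_sum _ _ _)) // big_seq; apply: (big_ind (fun k => k <= _)%N) => //.
    by move=> x y; rewrite geq_max => -> ->.
  move=> r rrs; rewrite (leq_trans (size_scale_leq _ _)) // -polyC1 size_monicM ?monicXsubC //.
    rewrite size_XsubC /= (leq_ltn_trans (size_scale_leq _ _)) // size_prod_XsubC size_rem //.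
    by rewrite prednK // lt0n size_eq0; case: (rs) rrs.
  by apply: contraNneq (Fr _ rrs) => ->; rewrite horner0.
- by rewrite /= n1.
rewrite /= rootE hornerD hornerN pE subrr; apply/andP; split.
  rewrite divfK ?(lt0r_neq0 f1) // big1 ?addr0 ?subrr // => r _.
  by rewrite mul0r mulr0.
apply/allP => r rrs; rewrite rootE hornerD hornerN pE (fE _ rrs) [(_ * F r).[r]]hornerM.
rewrite hornerXsubC subrr mul0r mulr0 add0r (big_rem r) //= big_seq big1 ?addr0.
  rewrite /a divfK ?subrr // mulf_neq0 ?Fr // subr_eq0.
  by apply: contraNneq n1 => <-.
move=> y yr; have -> : (F y).[r] = 0; last by rewrite !mulr0.
have ry : r \in rem y rs.
  by rewrite mem_rem_uniq // inE rrs andbT; apply: contraTneq yr => ->; rewrite mem_rem_uniqF.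
by apply/eqP; rewrite hornerZ mulf_eq0 -[_.[r] == 0]/(root _ _) root_prod_XsubC ry orbT.
Qed.

(** A zero r added to both arguments contributes (y + s - r)((s - r) y + s (s - 1)). For r = 0 this
    is s (y + s)(y + s - 1), and for r = 1 it is (s - 1)(y + s)(y + s - 1). *)
Lemma diamond_turn m n f g s : good m f -> good n g ->
  s * cval s (diamond (('X - 1) * f) (('X - 1) * g)) =
  (s - 1) * cval s (diamond ('X * f) ('X * g)).
Proof.
move=> [c [rs [_ _ _ ->]]] [d [ps [_ _ _ ->]]].
have E (e : R) r l : ('X - r%:P) * (e *: monic_roots l) = e *: monic_roots (r :: l).
  by rewrite -scalerAr /monic_roots big_cons.
have X0 : 'X = 'X - 0%:P :> {poly R} by rewrite subr0.
rewrite [in RHS]X0 -polyC1 !E !(diamondZl, diamondZr) !cvalZ.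
rewrite ![_ * (c%:C * _)]mulrCA ![_ * (d%:C * _)]mulrCA; do 2!(congr (_ * _)).
rewrite !cval_diamond.
set P := lin_prod (taylor_factors s rs ++ rev_taylor_factors s ps).
have PE r : (lin_prod (taylor_factors s (r :: rs) ++ rev_taylor_factors s (r :: ps)))`_(size (r :: ps)) =
    (s - r%:C) * ('X * P)`_(size ps) + ((s - r%:C) ^+ 2 + s * (s - 1)) * P`_(size ps)
    + (s - r%:C) * (s * (s - 1)) * P`_(size ps).+1.
  have -> : lin_prod (taylor_factors s (r :: rs) ++ rev_taylor_factors s (r :: ps)) =
      'X * ((s - r%:C) *: ('X * P) + ((s - r%:C) ^+ 2 + s * (s - 1)) *: P) +
      ((s - r%:C) * (s * (s - 1))) *: P.
    rewrite /P /lin_prod !big_cat /= !big_cons /= -!/(lin_prod _) scale1r.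
    rewrite -!mul_polyC !(polyCM, polyCD, polyCB, polyCN, polyC_exp, polyC1); ring.
    have XS (A : {poly R[i]}) k : ('X * A)`_k.+1 = A`_k by rewrite coefXM.
    by rewrite coefD XS coefD !coefZ.
rewrite !PE rmorph0 rmorph1; ring.
Qed.

Lemma diamond_interlace m n f1 f0 g1 g0 : good m f1 -> good m f0 -> good n g1 -> good n g0 ->
  interlace f1 f0 -> interlace g1 g0 -> interlace (diamond f1 g1) (diamond f0 g0).
Proof.
move=> gf1 gf0 gg1 gg0 f10 g10 s s0.
pose Q h k := sector s (cval s (diamond f1 g1)) (cval s (diamond h k)).
have QDl k h h' : Q h k -> Q h' k -> Q (h + h') k.
  by rewrite /Q diamondDl cvalD; apply: sectorDr.
have QZl k a h : 0 <= a -> Q h k -> Q (a *: h) k.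
  by rewrite /Q diamondZl cvalZ; apply: sectorZr.
have QDr k h h' : Q k h -> Q k h' -> Q k (h + h').
  by rewrite /Q diamondDr cvalD; apply: sectorDr.
have QZr k a h : 0 <= a -> Q k h -> Q k (a *: h).
  by rewrite /Q diamondZr cvalZ; apply: sectorZr.
have szf := good_size gf0; have szg := good_size gg0.
have hf x (x1 : 1 < x) := ltW (good_gt1 gf0 x1).
have hg x (x1 : 1 < x) := ltW (good_gt1 gg0 x1).
have [c [rs [c0 srs hrs f1E]]] := gf1; have [d [ps [d0 sps hps g1E]]] := gg1.
pose F r := c *: monic_roots (rem r rs); pose G r := d *: monic_roots (rem r ps).
have good_rem (e : R) l r : 0 < e -> (forall z, z \in l -> 0 <= z <= 1) -> r \in l ->
    good (size (rem r l)) (e *: monic_roots (rem r l)).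
  by move=> e0 hl rl; exists e, (rem r l); split=> // z /mem_rem /hl.
have good_X1 (k : nat) (h : {poly R}) : good k h -> good k.+1 (('X - 1) * h).
  move=> [e [l [e0 <- hl ->]]]; exists e, (1 :: l); split=> //.
    by move=> z; rewrite in_cons => /orP[/eqP->|/hl //]; rewrite ler01 lexx.
  by rewrite -scalerAr /monic_roots big_cons polyC1.
(* X - r is the convex combination of X - 1 and X with weights [r] and [1 - r]. *)
have remE (e : R) l r : r \in l -> e *: monic_roots l =
    r *: (('X - 1) * (e *: monic_roots (rem r l))) + (1 - r) *: ('X * (e *: monic_roots (rem r l))).
  move=> rl; rewrite (monic_roots_rem rl) -!mul_polyC !polyCB polyC1; ring.
(* By [interlace_cone], each argument on the right only has to run through generators: the left
   polynomial itself, or X - 1 times that polynomial with one linear factor removed. *)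
have coneg k : Q k g1 -> (forall r, r \in ps -> Q k (('X - 1) * G r)) -> Q k g0.
  move=> h1 h2; apply: (interlace_cone (Q := Q k) d0 hps) => //; rewrite -?g1E //.
  - by rewrite szg sps.
  - by move=> ? ?; apply: QDr.
  by move=> ? ?; apply: QZr.
have conef b : Q f1 b -> (forall r, r \in rs -> Q (('X - 1) * F r) b) -> Q f0 b.
  move=> h1 h2; apply: (interlace_cone (Q := fun h => Q h b) c0 hrs) => //; rewrite -?f1E //.
  - by rewrite szf srs.
  - by move=> ? ?; apply: QDl.
  by move=> ? ?; apply: QZl.
have comb r (a b z : R[i]) : 0 <= r <= 1 -> sector s a z -> sector s b z ->
    sector s (r%:C * a + (1 - r)%:C * b) z.
  by move=> /andP[r0 r1] az bz; apply: sectorDl; apply: sectorZl; rewrite ?subr_ge0.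
have cE r (k : {poly R}) : r \in rs -> cval s (diamond f1 k) = r%:C * cval s (diamond (('X - 1) * F r) k) +
    (1 - r)%:C * cval s (diamond ('X * F r) k).
  by move=> rrs; rewrite f1E (remE _ _ _ rrs) diamondDl !diamondZl cvalD !cvalZ.
have dE r (k : {poly R}) : r \in ps -> cval s (diamond k g1) = r%:C * cval s (diamond k (('X - 1) * G r)) +
    (1 - r)%:C * cval s (diamond k ('X * G r)).
  by move=> rps; rewrite g1E (remE _ _ _ rps) diamondDr !diamondZr cvalD !cvalZ.
have movef k h r : good k h -> r \in rs ->
    sector s (cval s (diamond ('X * F r) h)) (cval s (diamond (('X - 1) * F r) h)).
  move=> gh rrs; rewrite !(diamondC _ h).
  exact: diamond_interlace_move gh (good_rem _ _ _ c0 hrs rrs) s s0.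
have moveg k h r : good k h -> r \in ps ->
    sector s (cval s (diamond h ('X * G r))) (cval s (diamond h (('X - 1) * G r))).
  by move=> gh rps; apply: diamond_interlace_move gh (good_rem _ _ _ d0 hps rps) s s0.
apply: conef => [|r rrs]; apply: coneg => [|y yps].
- exact: sector_refl.
- rewrite /Q (dE y) //; apply: (comb); first exact: hps.
    exact: sector_refl.
  exact: moveg gf1 yps.
- rewrite /Q (cE r) //; apply: (comb); first exact: hrs.
    exact: sector_refl.
  exact: movef gg1 rrs.
have gF := good_X1 _ _ (good_rem _ _ _ c0 hrs rrs).
have gG := good_X1 _ _ (good_rem _ _ _ d0 hps yps).
rewrite /Q (cE r) // !(dE y) //; apply: (comb); first exact: hrs.
  apply: (comb); [exact: hps|exact: sector_refl|exact: moveg gF yps].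
apply: (comb); [exact: hps|exact: movef gG rrs|].
(* The remaining corner changes X into X - 1 in both arguments at once; by [diamond_turn] the
   quotient is exactly (s - 1) / s, the far boundary of the sector. *)
apply: (@sectorMI _ s s); first exact: Im_neq0.
rewrite (diamond_turn s (good_rem _ _ _ c0 hrs rrs) (good_rem _ _ _ d0 hps yps)).
exact: sector_turn (sector_refl _ s0).
Qed.
End Product.


(** * Sequences encoded by polynomials *)

Section Evaluation.
Variable R : rcfType.
Implicit Types (f g : {poly R}) (n : nat).

Definition ev f n : R := \sum_(a < size f) f`_a * 'C(n + a, a)%:R.

Lemma ev_wide N f n : (size f <= N)%N -> ev f n = \sum_(a < N) f`_a * 'C(n + a, a)%:R.
Proof.
move=> fN; rewrite /ev (big_ord_widen N (fun a => f`_a * 'C(n + a, a)%:R)) // big_mkcond.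
by apply: eq_bigr => a _; case: ltnP => // h; rewrite nth_default ?mul0r.
Qed.

Lemma evD f g n : ev (f + g) n = ev f n + ev g n.
Proof.
rewrite !(@ev_wide (maxn (size f) (size g))) ?leq_maxl ?leq_maxr ?size_polyD //.
by rewrite -big_split; apply: eq_bigr => a _; rewrite coefD mulrDl.
Qed.

Lemma evZ c f n : ev (c *: f) n = c * ev f n.
Proof.
rewrite (@ev_wide (size f)) ?size_scale_leq // mulr_sumr.
by apply: eq_bigr => a _; rewrite coefZ mulrA.
Qed.

Lemma ev0 n : ev 0 n = 0. Proof. by rewrite /ev size_poly0 big_ord0. Qed.

Lemma ev_sum (I : Type) (r : seq I) (P : pred I) (F : I -> {poly R}) n :
  ev (\sum_(i <- r | P i) F i) n = \sum_(i <- r | P i) ev (F i) n.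
Proof. by elim/big_rec2: _ => [|i x y _ <-]; rewrite ?ev0 ?evD. Qed.

Lemma ev1 n : ev 1 n = 1.
Proof. by rewrite /ev size_poly1 big_ord1 coef1 addn0 bin0 mulr1. Qed.

Lemma sum_bin_diag a n : (\sum_(m < n.+1) 'C(m + a, a) = 'C(n + a.+1, a.+1))%N.
Proof.
elim: n => [|n IH]; first by rewrite big_ord1 !add0n !binn.
by rewrite big_ord_recr /= IH !addSn !addnS binS.
Qed.

Lemma evX f n : ev ('X * f) n = \sum_(m < n.+1) ev f m.
Proof.
rewrite (@ev_wide (size f).+1); last by rewrite (leq_trans (size_polyMleq _ _)) // size_polyX.
rewrite big_ord_recl coefXM mul0r add0r exchange_big; apply: eq_bigr => a _ /=.
by rewrite coefXM /= -mulr_sumr -natr_sum sum_bin_diag.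
Qed.

Lemma evX1 f n : ev (('X - 1) * f) n = \sum_(m < n) ev f m.
Proof.
have -> : ('X - 1) * f = 'X * f + (-1) *: f by rewrite mulrBl mul1r scaleN1r.
by rewrite evD evZ evX big_ord_recr /= mulN1r addrK.
Qed.

Lemma sum_bin_subdiag a k n :
  (\sum_(m < n) 'C(m + a, a + k) = 'C(n + a, (a + k).+1))%N.
Proof.
elim: n => [|n IH]; first by rewrite big_ord0 bin_small // add0n ltnS leq_addr.
by rewrite big_ord_recr /= IH addSn binS addnC.
Qed.

(** Each factor X is a prefix sum including the last index and each factor X - 1 one excluding it;
    the hockey-stick identities evaluate them. *)
Lemma evXn_X1n a k n : ev (('X - 1) ^+ k * 'X^a) n = 'C(n + a, a + k)%:R.
Proof.
elim: k n => [|k IHk] n.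
  rewrite mul1r addn0; elim: a n => [|a IHa] n; first by rewrite ev1 bin0.
  by rewrite exprS evX (eq_bigr _ (fun (m : 'I_n.+1) _ => IHa m)) -natr_sum sum_bin_diag.
rewrite exprS -mulrA evX1 (eq_bigr _ (fun (m : 'I_n) _ => IHk m)).
by rewrite -natr_sum sum_bin_subdiag addnS.
Qed.

(** Pascal's rule on the first right-hand binomial gives total weight a + b + 1 to the second one,
    which absorption turns into n - k; finally (a + 1 + k) + (n - k) = n + a + 1. *)
Lemma mul_bin_step a b k n : (k <= a)%N -> (k <= b)%N ->
  ((n + a).+1 * 'C(n + (a + b - k), a + b) =
  (a.+1 + k) * 'C(n + (a.+1 + b - k), (a + b).+1) +
  (b - k) * 'C(n + (a + b - k), (a + b).+1))%N.
Proof.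
move=> ka kb; rewrite addSn subSn ?(leq_trans ka) ?leq_addr // addnS binS.
set m := (a + b - k)%N; rewrite mulnDr addnAC -mulnDl.
have -> : (a.+1 + k + (b - k) = (a + b).+1)%N by lia.
rewrite mul_bin_left -mulnDl; have [kn|nk] := leqP k n.
  by congr (_ * _)%N; rewrite /m; lia.
by rewrite bin_small ?muln0 // /m; lia.
Qed.

Lemma mul_bin_bin a b n : ('C(n + a, a) * 'C(n + b, b) =
  \sum_(k < a.+1) 'C(a, k) * 'C(b, k) * 'C(n + (a + b - k), a + b))%N.
Proof.
elim: a => [|a IH]; first by rewrite big_ord1 !bin0 !add0n subn0 !mul1n.
(* Multiplying by a + 1 replaces C(n + a + 1, a + 1) by (n + a + 1) C(n + a, a), so the induction
   hypothesis applies. *)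
apply/eqP; rewrite -(eqn_pmul2l (ltn0Sn a)) mulnA addnS -mul_bin_diag /= -mulnA IH.
rewrite !big_distrr /=; apply/eqP.
have step k : (k < a.+1)%N -> ((n + a).+1 * ('C(a, k) * 'C(b, k) * 'C(n + (a + b - k), a + b)) =
    (a.+1 + k) * ('C(a, k) * 'C(b, k) * 'C(n + (a.+1 + b - k), (a + b).+1)) +
    k.+1 * ('C(a, k) * 'C(b, k.+1) * 'C(n + (a + b - k), (a + b).+1)))%N.
  move=> ka; have [kb|bk] := leqP k b; last first.
    have e1 : 'C(b, k) = 0%N by apply: bin_small.
    have e2 : 'C(b, k.+1) = 0%N by apply: bin_small; apply: ltnW.
    by rewrite e1 e2 !(muln0, mul0n).
  have := mul_bin_left b k; have := mul_bin_step n (ka : (k <= a)%N) kb.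
  move: 'C(n + (a + b - k), (a + b).+1) 'C(n + (a.+1 + b - k), _) 'C(n + _, _).
  move: 'C(a, k) 'C(b, k) 'C(b, k.+1) (n + a).+1 (a.+1 + k)%N (b - k)%N k.+1.
  move=> x y z N A B K u v t h1 h2.
  transitivity (x * y * (N * t))%N; first by ring.
  rewrite h1; transitivity (A * (x * y * v) + x * (B * y) * u)%N; first by ring.
  by rewrite -h2; ring.
rewrite (eq_bigr _ (fun (k : 'I_a.+1) _ => step k (ltn_ord k))) big_split /=.
pose T k := ('C(b, k) * 'C(n + (a.+1 + b - k), (a + b).+1))%N.
(* The second sum is shifted by one. Its new term at [k = 0] carries the factor 0, so the value of
   [k.-1] there is harmless. *)
transitivity (\sum_(k < a.+2) (a.+1 + k) * ('C(a, k) * T k) +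
              \sum_(k < a.+2) k * ('C(a, k.-1) * T k))%N.
  congr (_ + _)%N.
    rewrite [RHS]big_ord_recr /= (@bin_small a a.+1) // mul0n muln0 addn0.
    by apply: eq_bigr => k _; rewrite /T !mulnA.
  rewrite [RHS]big_ord_recl /= mul0n add0n; apply: eq_bigr => k _.
  by rewrite /T /bump /= add1n addSn subSS !mulnA.
rewrite -big_split /=; apply: eq_bigr => -[k /= kp] _; rewrite -!mulnA -/(T k) addSn.
case: k kp => [|k] /= ka; first by rewrite !bin0 mul0n !addn0.
rewrite binS; have := mul_bin_left a k; rewrite !mulnA -!mulnDl => E; congr (_ * _)%N.
congr (_ * _)%N; have e : (k.+1 * 'C(a, k.+1) + k.+1 * 'C(a, k) = a.+1 * 'C(a, k))%N.
  by rewrite E -mulnDl; congr (_ * _)%N; lia.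
by rewrite mulnDr -e; ring.
Qed.

(** By bilinearity it suffices to take monomials: the [k]-th term for X^a and X^b is C(a, k) C(b, k)
    (X - 1)^k X^(a + b - k), which matches [mul_bin_bin] term by term. *)
Lemma ev_diamond f g n : ev (diamond f g) n = ev f n * ev g n.
Proof.
have monom a b : ev (diamond 'X^a 'X^b) n = ev 'X^a n * ev 'X^b n.
  have evXn c : ev 'X^c n = 'C(n + c, c)%:R.
    by have := evXn_X1n c 0 n; rewrite expr0 mul1r addn0.
  rewrite !evXn -natrM mul_bin_bin /diamond size_polyXn ev_sum natr_sum.
  apply: eq_bigr => -[k /= ka] _; rewrite !nderivnXn.
  have [kb|bk] := leqP k b; last by rewrite (@bin_small b) // !mulr0n mulr0 mul0r ev0 muln0 mul0n.
  have -> : 'X^(a - k) *+ 'C(a, k) * ('X^(b - k) *+ 'C(b, k)) * ('X * ('X - 1)) ^+ k =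
      ('C(a, k) * 'C(b, k))%:R *: (('X - 1) ^+ k * 'X^(a + b - k)) :> {poly R}.
    have -> : (a + b - k = a - k + (b - k) + k)%N by lia.
    rewrite scaler_nat !(mulrnAl, mulrnAr) -mulrnA mulnC; congr (_ *+ _).
    by rewrite !exprD exprMn; ring.
  by rewrite evZ evXn_X1n -natrM; congr (_ * 'C(_, _))%:R; lia.
rewrite -[f]coefK -[g]coefK !poly_def.
have DS (I : Type) (r : seq I) (F : I -> {poly R}) h : diamond (\sum_(i <- r) F i) h = \sum_(i <- r) diamond (F i) h.
  elim: r => [|i r IH]; last by rewrite !big_cons diamondDl IH.
  by rewrite !big_nil /diamond size_poly0 big_ord0.
rewrite DS !ev_sum mulr_suml; apply: eq_bigr => i _.
rewrite diamondC DS ev_sum mulr_sumr; apply: eq_bigr => j _.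
by rewrite diamondZl diamondC diamondZl !evZ monom; ring.
Qed.

End Evaluation.


(** * Interlacing families *)

Section Families.
Variable R : rcfType.
Implicit Types (f g : {poly R}) (s D : nat) (W : nat -> R).

Definition interlacing_family s D W : Prop := exists Phi : nat -> {poly R},
  [/\ forall j, (j < s)%N -> good D (Phi j),
      forall j k, (j <= k < s)%N -> interlace (Phi k) (Phi j)
    & forall n j, (j < s)%N -> W (n * s + j)%N = ev (Phi j) n].

Lemma interlace_refl f : interlace f f.
Proof. by move=> z z0; apply: sector_refl. Qed.

Lemma size_coef_mul f g a b : (size f <= a.+1)%N -> (size g <= b.+1)%N ->
  (size (f * g)%R <= (a + b).+1)%N /\ (f * g)`_(a + b) = f`_a * g`_b.
Proof.
move=> fa gb; split.
  by rewrite (leq_trans (size_polyMleq _ _)) //; move: (leq_add fa gb); lia.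
rewrite coefM (bigD1 (inord a)) //= inordK ?ltnS ?leq_addr // addKn big1 ?addr0 // => i.
rewrite -val_eqE /= inordK ?ltnS ?leq_addr // neq_ltn => /orP[ia|ai].
  rewrite [g`_ _]nth_default ?mulr0 // (leq_trans gb) //; move: (ltn_ord i); lia.
by rewrite nth_default ?mul0r // (leq_trans fa).
Qed.

Lemma size_nderivn_le f k m : (size f <= m.+1)%N -> (k <= m)%N ->
  (size f^`N(k) <= (m - k).+1)%N.
Proof.
move=> fm km; apply/leq_sizeP => i mi; rewrite coef_nderivn nth_default ?mul0rn //.
by rewrite (leq_trans fm) // -leq_subLR subSn.
Qed.

(** The coefficient at m + n is f_m g_n times the sum of C(m, k) C(n, k), whose term at k = 0 is
    already positive. *)
Lemma diamond_lead m n f g : good m f -> good n g ->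
  (size (diamond f g) <= (m + n).+1)%N /\ 0 < (diamond f g)`_(m + n).
Proof.
move=> gf gg; have fm := good_lead gf; have gn := good_lead gg.
have sf := good_size gf; have sg := good_size gg.
have term k : (k <= m)%N -> (k <= n)%N ->
    (size (f^`N(k) * g^`N(k) * ('X * ('X - 1)) ^+ k)%R <= (m + n).+1)%N /\
    (f^`N(k) * g^`N(k) * ('X * ('X - 1)) ^+ k)`_(m + n) =
      f`_m * g`_n *+ ('C(m, k) * 'C(n, k)).
  move=> km kn; have [s1 c1] := size_coef_mul
    (size_nderivn_le (eq_leq sf) km) (size_nderivn_le (eq_leq sg) kn).
  have mX : ('X * ('X - 1)) ^+ k \is @monic R.
    by rewrite monic_exp // monicMl ?monicX // -polyC1 monicXsubC.
  have sX : size ('X * ('X - 1) : {poly R}) = 3.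
    by rewrite -polyC1 mulrC size_Mmonic ?monicX ?polyXsubC_eq0 // size_XsubC size_polyX.
  have sXk : (size (('X * ('X - 1)) ^+ k : {poly R}) = (k + k).+1)%N.
    have z0 : (0 < size (('X * ('X - 1)) ^+ k : {poly R}))%N by rewrite size_poly_gt0 monic_neq0.
    by rewrite -(ltn_predK z0) size_exp sX /= mul2n addnn.
  have [s2 c2] := size_coef_mul s1 (eq_leq sXk).
  have E : (m - k + (n - k) + (k + k) = m + n)%N by lia.
  rewrite E in s2 c2; split=> //; rewrite c2 c1 !coef_nderivn !subnKC //.
  move/monicP: mX; rewrite /lead_coef sXk /= => ->.
  by rewrite mulr1 mulrnAl mulrnAr -mulrnA mulnC.
split.
  rewrite (leq_trans (size_sum _ _ _)) //; apply/bigmax_leqP => -[k /=]; rewrite sf ltnS => km _.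
  have [kn|nk] := leqP k n; first exact: (term k km kn).1.
  by rewrite [g^`N(k)]nderivn_poly0 ?sg // mulr0 mul0r size_poly0.
rewrite coef_sum sf big_ord_recl (term 0%N (leq0n _) (leq0n _)).2 !bin0 mulr1n ltr_pwDl ?mulr_gt0 //.
apply: sumr_ge0 => -[k /= km] _; have [kn|nk] := leqP (bump 0 k) n.
  by rewrite (term _ km kn).2 mulrn_wge0 // mulr_ge0 // ltW.
by rewrite [g^`N(_)]nderivn_poly0 ?sg // mulr0 mul0r coef0.
Qed.

(** With [e] a sign, the hypothesis puts [x] on one side of all zeros. There the k-th derivative has
    the sign e^(n - k), which equals e^(n + k). *)
Lemma nderivn_sign_ge0 (e x : R) c (rs : seq R) k : e * e = 1 -> 0 < c ->
  (forall r, r \in rs -> 0 < e * (x - r)) ->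
  0 <= e ^+ (size rs) * e ^+ k * ((c *: monic_roots rs)^`N(k)).[x].
Proof.
move=> ee c0 h; rewrite linearZ /= hornerZ mulrCA mulr_ge0 ?(ltW c0) //.
elim: rs k h => [|r rs IH] k h.
  rewrite /monic_roots big_nil; case: k => [|k]; first by rewrite nderivn0 hornerC !expr0 !mulr1.
  by rewrite nderivnC /= horner0 mulr0.
have hr := h r (mem_head _ _).
have {}IH k' := IH k' (fun y yr => h y (mem_behead (yr : y \in behead (r :: rs)))).
rewrite /monic_roots big_cons -/(monic_roots rs); case: k => [|k].
  rewrite nderivn0 hornerM hornerXsubC /= exprS !expr0 mulr1.
  have := IH 0%N; rewrite nderivn0 expr0 mulr1 => {}IH.
  by rewrite mulrACA; apply: mulr_ge0; [exact: ltW|].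
rewrite nderivnS_XsubC_mul hornerD hornerM hornerXsubC /=.
have -> : e ^+ (size rs).+1 * e ^+ k.+1 * ((x - r) * (monic_roots rs)^`N(k.+1).[x] +
    (monic_roots rs)^`N(k).[x]) =
    (e * (x - r)) * (e ^+ size rs * e ^+ k.+1 * (monic_roots rs)^`N(k.+1).[x]) +
    (e * e) * (e ^+ size rs * e ^+ k * (monic_roots rs)^`N(k).[x]).
  by rewrite !exprS; ring.
by rewrite ee mul1r addr_ge0 // mulr_ge0 // ltW.
Qed.

(** Outside [0, 1] the factor x (x - 1) is positive, so no term of [diamond] has the sign opposite
    to e^(m + n), and the term k = 0 is nonzero. *)
Lemma diamond_sign_gt0 (e x : R) m n f g : e * e = 1 ->
  (forall r, 0 <= r <= 1 -> 0 < e * (x - r)) -> good m f -> good n g ->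
  0 < e ^+ (m + n) * (diamond f g).[x].
Proof.
move=> ee h [c [rs [c0 <- hrs ->]]] [d [ps [d0 <- hps ->]]].
have e0 : e != 0 by apply: contra_eq_neq ee => ->; rewrite mul0r eq_sym oner_neq0.
have hf k := nderivn_sign_ge0 k ee c0 (fun r rr => h r (hrs r rr)).
have hg k := nderivn_sign_ge0 k ee d0 (fun r rr => h r (hps r rr)).
have x0 : 0 < e * (x - 0) by apply: h; rewrite lexx ler01.
have x1 : 0 < e * (x - 1) by apply: h; rewrite lexx ler01.
have u0 : 0 < x * (x - 1).
  by have := mulr_gt0 x0 x1; rewrite mulrACA ee mul1r subr0.
have ek k : e ^+ k * e ^+ k = 1 by rewrite -exprMn ee expr1n.
have pos y (l : seq R) : 0 < y -> (forall r, r \in l -> 0 <= r <= 1) ->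
    0 < e ^+ size l * (y *: monic_roots l).[x].
  move=> y0 hl; rewrite hornerZ mulrCA mulr_gt0 //.
  rewrite /monic_roots horner_prod; elim: l hl => [|r l IH] hl.
    by rewrite big_nil mulr1 ltr01.
  rewrite big_cons exprS mulrACA mulr_gt0 ?hornerXsubC //; first by apply: h; apply: hl (mem_head _ _).
  by apply: IH => z zl; apply: hl; rewrite in_cons zl orbT.
have termE k : e ^+ (size rs + size ps) * ((c *: monic_roots rs)^`N(k) *
    (d *: monic_roots ps)^`N(k) * ('X * ('X - 1)) ^+ k).[x] =
  (e ^+ size rs * e ^+ k * (c *: monic_roots rs)^`N(k).[x]) *
  (e ^+ size ps * e ^+ k * (d *: monic_roots ps)^`N(k).[x]) * (x * (x - 1)) ^+ k.
  rewrite exprD !hornerM horner_exp hornerM -polyC1 hornerXsubC hornerX.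
  transitivity ((e ^+ k * e ^+ k) * (e ^+ size rs * e ^+ size ps *
    ((c *: monic_roots rs)^`N(k).[x] * (d *: monic_roots ps)^`N(k).[x] * (x * (x - 1)) ^+ k))).
    by rewrite ek mul1r.
  ring.
rewrite /diamond horner_sum mulr_sumr size_scale ?gt_eqF // size_prod_XsubC big_ord_recl.
rewrite ltr_pwDl //.
  by rewrite termE !expr0 !mulr1 !nderivn0; apply: mulr_gt0; apply: pos.
apply: sumr_ge0 => k _; rewrite termE; apply: mulr_ge0; first exact: mulr_ge0.
by rewrite exprn_ge0 // ltW.
Qed.

Lemma good_diamond m n f g : good m f -> good n g -> good (m + n) (diamond f g).
Proof.
move=> gf gg; have [sz lc] := diamond_lead gf gg; apply: goodI => //.
- by move=> z; apply: cval_diamond_neq0 gf gg.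
- move=> x x1; have := @diamond_sign_gt0 1 x m n f g; rewrite expr1n !mul1r; apply=> // r.
  by move=> /andP[_ r1]; rewrite mul1r subr_gt0 (le_lt_trans r1).
move=> x x0; apply: diamond_sign_gt0 => //; first by rewrite mulrNN mulr1.
by move=> r /andP[r0 _]; rewrite mulN1r opprB subr_gt0 (lt_le_trans x0).
Qed.

Lemma family_mul s D1 D2 W1 W2 : interlacing_family s D1 W1 -> interlacing_family s D2 W2 ->
  interlacing_family s (D1 + D2) (fun m => W1 m * W2 m).
Proof.
move=> [F [gF iF eF]] [G [gG iG eG]]; exists (fun j => diamond (F j) (G j)); split.
- by move=> j js; apply: good_diamond; [apply: gF|apply: gG].
- move=> j k /andP[jk ks]; have js := leq_ltn_trans jk ks.
  apply: diamond_interlace (gF _ ks) (gF _ js) (gG _ ks) (gG _ js) _ _.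
    by apply: iF; rewrite jk.
  by apply: iG; rewrite jk.
by move=> n j js; rewrite eF // eG // ev_diamond.
Qed.

Lemma good1 : good 0 (1 : {poly R}).
Proof. by exists 1, [::]; split=> //; rewrite /monic_roots big_nil scale1r. Qed.

Lemma good_X_mul D f : good D f -> good D.+1 ('X * f).
Proof.
move=> [c [rs [c0 <- hrs ->]]]; exists c, (0 :: rs); split=> //.
  by move=> r; rewrite in_cons => /orP[/eqP->|/hrs //]; rewrite lexx ler01.
by rewrite -scalerAr /monic_roots big_cons subr0.
Qed.

Lemma good_X1_mul D f : good D f -> good D.+1 (('X - 1) * f).
Proof.
move=> [c [rs [c0 <- hrs ->]]]; exists c, (1 :: rs); split=> //.
  by move=> r; rewrite in_cons => /orP[/eqP->|/hrs //]; rewrite lexx ler01.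
by rewrite -scalerAr /monic_roots big_cons polyC1.
Qed.

Lemma good_X1n_Xn a k : good (a + k) (('X - 1) ^+ k * 'X^a : {poly R}).
Proof.
elim: k => [|k IH]; last by rewrite exprS -mulrA addnS; apply: good_X1_mul.
rewrite mul1r addn0; elim: a => [|a IH]; first exact: good1.
by rewrite exprS; apply: good_X_mul.
Qed.

Lemma family1 s : interlacing_family s 0 (fun=> 1).
Proof.
exists (fun=> 1); split=> [j _|j k _|n j _]; [exact: good1|exact: interlace_refl|].
by rewrite ev1.
Qed.

Lemma family_prod s (I : Type) (r : seq I) (P : pred I) (D : I -> nat) (W : I -> nat -> R) :
  (forall i, P i -> interlacing_family s (D i) (W i)) ->
  interlacing_family s (\sum_(i <- r | P i) D i)%N (fun m => \prod_(i <- r | P i) W i m).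
Proof.
move=> h; elim: r => [|i r IH].
  rewrite big_nil; have -> : (fun m => \prod_(i <- [::] | P i) W i m) = fun=> 1.
    by apply/funext => m; rewrite big_nil.
  exact: family1.
case: (boolP (P i)) => Pi.
  rewrite big_cons Pi; have -> : (fun m => \prod_(i <- i :: r | P i) W i m) =
      (fun m => W i m * \prod_(i <- r | P i) W i m).
    by apply/funext => m; rewrite big_cons Pi.
  by apply: family_mul; [apply: h|].
rewrite big_cons (negPf Pi); have -> : (fun m => \prod_(i <- i :: r | P i) W i m) =
    (fun m => \prod_(i <- r | P i) W i m).
  by apply/funext => m; rewrite big_cons (negPf Pi).
exact: IH.
Qed.

Lemma sector_sum (z : R[i]) (I J : Type) (r : seq I) (r' : seq J) (P : pred I) (P' : pred J)
    (F : I -> R[i]) (G : J -> R[i]) :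
  (forall i j, P i -> P' j -> sector z (F i) (G j)) ->
  sector z (\sum_(i <- r | P i) F i) (\sum_(j <- r' | P' j) G j).
Proof.
move=> h; apply: (big_ind (fun x => sector z x _)); first exact: sector0l.
  by move=> x y; apply: sectorDl.
move=> i Pi; apply: big_ind; first exact: sector0r.
  by move=> x y; apply: sectorDr.
by move=> j; apply: h.
Qed.

(** * Prefix sums of interlacing families *)

Section Prefix.
Variables (s D : nat) (Phi : nat -> {poly R}).
Hypothesis s0 : (0 < s)%N.
Hypothesis gPhi : forall j, (j < s)%N -> good D (Phi j).
Hypothesis iPhi : forall j k, (j <= k < s)%N -> interlace (Phi k) (Phi j).

(* Residues below k contribute their terms up to n, the others only up to n - 1;
   on encodings these summations are multiplication by 'X and by 'X - 1. *)
Definition prefix_poly k : {poly R} :=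
  'X * (\sum_(0 <= i < k) Phi i) + ('X - 1) * (\sum_(k <= i < s) Phi i).

Lemma prefix_poly_split k : (k <= s)%N ->
  prefix_poly k = \sum_(i < s) (if (i < k)%N then 'X else 'X - 1) * Phi i.
Proof.
move=> ks; rewrite -(big_mkord xpredT (fun i => (if (i < k)%N then 'X else 'X - 1) * Phi i)).
rewrite (big_cat_nat (leq0n k) ks) /= /prefix_poly !mulr_sumr.
congr (_ + _); apply: eq_big_nat => i /andP[h1 h2]; first by rewrite h2.
by rewrite ltnNge h1.
Qed.

(** A block of higher indices is related to a block of lower ones term by term; [d <= a.+1] lets the
    two blocks share the index [a]. *)
Lemma sector_block z a b c d : 0 < complex.Im z -> (d <= a.+1)%N -> (b <= s)%N ->
  sector z (cval z (\sum_(a <= i < b) Phi i)) (cval z (\sum_(c <= i < d) Phi i)).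
Proof.
move=> z0 da bs; rewrite !cval_sum [X in sector _ X _]big_nat [X in sector _ _ X]big_nat.
apply: sector_sum => i j /andP[ai ib] /andP[cj jd].
by apply: iPhi => //; rewrite (leq_trans ib bs) andbT -ltnS (leq_trans jd) // (leq_trans da).
Qed.

Lemma cval_prefixE k z : cval z (prefix_poly k) =
  z * cval z (\sum_(0 <= i < k) Phi i) + (z - 1) * cval z (\sum_(k <= i < s) Phi i).
Proof. by rewrite /prefix_poly cvalD !cvalM cvalX cvalX1. Qed.

(** One summand is isolated, the last one for [k = 0] and otherwise the last one multiplied by X.
    The rest lies in its sector, so a zero sum would make that summand zero. *)
Lemma cval_prefix_neq0 k z : (k <= s)%N -> 0 < complex.Im z -> cval z (prefix_poly k) != 0.
Proof.
move=> ks z0; rewrite cval_prefixE; have z1 : z - 1 != 0.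
  by rewrite -[1]/(real_complex R 1) Im_neq0 // Im_subr.
have zz : z != 0 by apply: Im_neq0.
case: k ks => [_|k ks].
  rewrite [X in cval z X](@big_geq _ _ _ 0%N 0%N) // cval0 mulr0 add0r mulf_neq0 //.
  have P0 : cval z (\sum_(s.-1 <= i < s.-1.+1) Phi i) != 0.
    by rewrite big_nat1; apply: good_neq0 z0; apply: gPhi; rewrite prednK.
  rewrite -{1}(prednK s0) (big_cat_nat (leq0n s.-1) (leqnSn _)) /= cvalD addrC.
  apply: contra_neq P0 => /(sector_add_eq0 z0); apply.
  by apply: sector_block; rewrite ?leqnSn ?prednK.
have k1 : cval z (\sum_(k <= i < k.+1) Phi i) != 0.
  by rewrite big_nat1; apply: good_neq0 z0; apply: gPhi.
rewrite (big_cat_nat (leq0n k) (leqnSn k)) /= cvalD mulrDr [_ + z * _]addrC -addrA.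
apply: contra_neq k1 => /(sector_add_eq0 z0) h.
suff /eqP : z * cval z (\sum_(k <= i < k.+1) Phi i) = 0.
  by rewrite mulf_eq0 (negPf zz) => /eqP.
apply: h; apply: sectorDr; first by apply: sectorM; apply: sector_block => //; rewrite leqnSn.
by apply: sector_turn; apply: sector_block.
Qed.

(** Only the block [B] between [k] and [k'] changes its multiplier. The two values are [U + z * B]
    and [U + (z - 1) * B], and the four pairs of summands are all related. *)
Lemma interlace_prefix k k' : (k <= k' <= s)%N -> interlace (prefix_poly k') (prefix_poly k).
Proof.
move=> /andP[kk ks] z z0; rewrite !cval_prefixE.
rewrite (big_cat_nat (leq0n k) kk) [X in sector _ _ (_ + _ * cval z X)](big_cat_nat kk ks) /= !cvalD.
set A := cval z (\sum_(0 <= i < k) _); set B := cval z (\sum_(k <= i < k') _).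
set C := cval z (\sum_(k' <= i < s) _).
have BA : sector z B A by apply: sector_block; rewrite // leqnSn.
have CA : sector z C A by apply: sector_block; rewrite // ltnW.
have CB : sector z C B by apply: sector_block; rewrite // leqnSn.
have BB : sector z (z * B) ((z - 1) * B) by apply: sector_turn; apply: sector_refl.
pose U := z * A + (z - 1) * C.
have UU : sector z U U by apply: sector_refl.
have BU : sector z (z * B) U by apply: sectorDr; [apply: sectorM|apply: sector_turn].
have UB : sector z U ((z - 1) * B) by apply: sectorDl; [apply: sector_turn|apply: sectorM].
have -> : z * (A + B) + (z - 1) * C = U + z * B by rewrite /U; ring.
have -> : z * A + (z - 1) * (B + C) = U + (z - 1) * B by rewrite /U; ring.
by apply: sectorDl; apply: sectorDr.
Qed.

Lemma sum_lt_gt0 (F : nat -> R) : (forall i, (i < s)%N -> 0 < F i) -> 0 < \sum_(i < s) F i.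
Proof.
move=> h; case: s s0 h => // n _ h; rewrite big_ord_recl ltr_pwDl ?h //.
by apply: sumr_ge0 => i _; apply: ltW; apply: h; rewrite /bump /= ltnS.
Qed.

Lemma good_prefix k : (k <= s)%N -> good D.+1 (prefix_poly k).
Proof.
move=> ks; have lin i : (if (i < k)%N then 'X else 'X - 1) = 'X - (~~ (i < k)%N)%:R%:P :> {poly R}.
  by case: (i < k)%N; rewrite /= ?polyC1 ?polyC0 ?subr0.
have E := prefix_poly_split ks; apply: goodI.
- rewrite E (leq_trans (size_sum _ _ _)) //; apply/bigmax_leqP => -[i /= js] _.
  by rewrite lin mulrC size_Mmonic ?monicXsubC // -?size_poly_eq0 ?(good_size (gPhi js)) ?size_XsubC // addn2.
- rewrite E coef_sum; apply: (sum_lt_gt0 (F := fun i => ((if (i < k)%N then 'X else 'X - 1) * Phi i)`_D.+1)).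
  move=> i js; rewrite lin mulrBl coefB coefXM coefCM /= [(Phi i)`_D.+1]nth_default ?mulr0 ?subr0.
    exact: good_lead (gPhi js).
  by rewrite (good_size (gPhi js)).
- by move=> z; apply: cval_prefix_neq0.
- move=> x x1; rewrite E horner_sum.
  apply: (sum_lt_gt0 (F := fun i => ((if (i < k)%N then 'X else 'X - 1) * Phi i).[x])).
  move=> i js; rewrite lin hornerM hornerXsubC mulr_gt0 ?(good_gt1 (gPhi js)) // subr_gt0.
  by case: (i < k)%N => //=; rewrite (lt_trans ltr01).
move=> x x0; rewrite E horner_sum mulr_sumr.
apply: (sum_lt_gt0 (F := fun i => (-1) ^+ D.+1 * ((if (i < k)%N then 'X else 'X - 1) * Phi i).[x])).
move=> i js; rewrite lin hornerM hornerXsubC exprS mulrACA mulr_gt0 ?(good_lt0 (gPhi js)) //.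
rewrite mulN1r opprB subr_gt0 (lt_le_trans x0) //; exact: ler0n.
Qed.

Lemma ev_prefix W n k : (k <= s)%N ->
  (forall n j, (j < s)%N -> W (n * s + j)%N = ev (Phi j) n) ->
  \sum_(m < n * s + k) W m = ev (prefix_poly k) n.
Proof.
move=> ks h.
have shift a c : \sum_(a <= i < a + c) W i = \sum_(0 <= i < c) W (i + a)%N.
  by rewrite -{1}[a]add0n big_addn addKn.
have full n' : \sum_(0 <= m < n' * s) W m = \sum_(0 <= i < s) \sum_(m < n') ev (Phi i) m.
  elim: n' => [|n' IH]; first by rewrite big_geq // big1 // => i _; rewrite big_ord0.
  rewrite mulSnr (big_cat_nat (leq0n (n' * s)%N) (leq_addr _ _)) /= IH.
  rewrite shift -big_split /=.
  by apply: eq_big_nat => i /andP[_ js]; rewrite big_ord_recr addnC h.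
rewrite -(big_mkord xpredT W) (big_cat_nat (leq0n (n * s)%N) (leq_addr _ _)) /= full.
rewrite shift.
rewrite /prefix_poly !mulr_sumr evD !ev_sum.
rewrite (big_cat_nat (leq0n k) ks) /= addrAC -big_split /=; congr (_ + _).
  apply: eq_big_nat => i /andP[_ ik]; rewrite evX big_ord_recr /= addnC h //.
  exact: leq_trans ik ks.
by apply: eq_big_nat => i _; rewrite evX1.
Qed.

End Prefix.

(** The bound [cut] increases by [s] whenever its argument increases by [s'], so residues modulo
    [s'] on the outside correspond to the prefix lengths [kappa] modulo [s] on the inside. This is
    how a leaf passes its sum to a parent with another period. *)
Lemma family_cut s s' D W (cut kappa : nat -> nat) : (0 < s)%N ->
  interlacing_family s D W ->
  (forall n j, (j < s')%N -> cut (n * s' + j)%N = (n * s + kappa j)%N) ->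
  (forall j, (j < s')%N -> (kappa j <= s)%N) ->
  (forall j k, (j <= k)%N -> (kappa j <= kappa k)%N) ->
  interlacing_family s' D.+1 (fun m => \sum_(i < cut m) W i).
Proof.
move=> s0 [Phi [gP iP eP]] hc hk mono; exists (fun j => prefix_poly s Phi (kappa j)); split.
- by move=> j js; apply: good_prefix => //; apply: hk.
- by move=> j k /andP[jk ks]; apply: interlace_prefix => //; rewrite mono //= hk.
by move=> n j js; rewrite hc // (ev_prefix (Phi := Phi)) // hk.
Qed.

(** Starting from the constant 1, take [a] inclusive and then [c] exclusive prefix sums. *)
Lemma family_bin s a c : (0 < s)%N ->
  interlacing_family s (a + c) (fun m => 'C(m + a, a + c)%:R).
Proof.
move=> s0; elim: c => [|c IH].
  rewrite addn0; elim: a => [|a IH].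
    have -> : (fun m => 'C(m + 0, 0)%:R) = (fun=> 1 : R) by apply/funext => m; rewrite bin0.
    exact: family1.
  have -> : (fun m => 'C(m + a.+1, a.+1)%:R) = (fun m => \sum_(i < m.+1) 'C(i + a, a)%:R : R).
    by apply/funext => m; rewrite -natr_sum sum_bin_diag.
  by apply: (family_cut (cut := S) (kappa := S) s0 IH) => // n j _; rewrite addnS.
have -> : (fun m => 'C(m + a, a + c.+1)%:R) = (fun m => \sum_(i < m) 'C(i + a, a + c)%:R : R).
  by apply/funext => m; rewrite -natr_sum sum_bin_subdiag addnS.
rewrite addnS; apply: (family_cut (cut := id) (kappa := id) s0 IH) => // j; exact: ltnW.
Qed.

Lemma family_floor s a c : interlacing_family s (a + c) (fun m => 'C(m %/ s + a, a + c)%:R).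
Proof.
exists (fun=> ('X - 1) ^+ c * 'X^a); split.
- by move=> j _; apply: good_X1n_Xn.
- by move=> j k _; apply: interlace_refl.
move=> n j js; rewrite evXn_X1n divnMDl ?divn_small ?addn0 //.
exact: leq_ltn_trans js.
Qed.

(** At n s + j the ceiling is n for j = 0 and n + 1 for every other residue. So only two polynomials
    occur, with quotient (X - 1) / X. *)
Lemma family_ceil s a c : interlacing_family s (a + c.+1)
  (fun m => 'C((m + s.-1) %/ s + a, a + c.+1)%:R).
Proof.
pose F j : {poly R} := if j == 0%N then ('X - 1) ^+ c.+1 * 'X^a else ('X - 1) ^+ c * 'X^(a.+1).
exists F; split.
- by move=> [|j] _; rewrite /F /=; [|rewrite addnS -addSn]; apply: good_X1n_Xn.
- move=> [|j] [|k] jk; rewrite /F //=; try exact: interlace_refl.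
  have -> : ('X - 1) ^+ c.+1 * ('X^a) = ('X - 1) * (('X - 1) ^+ c * ('X^a)) :> {poly R}.
    by rewrite exprS mulrA.
  have -> : ('X - 1) ^+ c * 'X^(a.+1) = 'X * (('X - 1) ^+ c * ('X^a)) :> {poly R}.
    by rewrite exprS mulrCA.
  move=> z z0; rewrite !(cvalM _ _ (_ * 'X^a)) cvalX cvalX1.
  by apply: sector_turn; apply: sector_refl.
move=> n j js; have s0 : (0 < s)%N by apply: leq_ltn_trans js.
rewrite -addnA divnMDl // /F; case: j js => [|j] js /=.
  by rewrite evXn_X1n add0n divn_small ?prednK // addn0.
have -> : ((j.+1 + s.-1) %/ s = 1)%N.
  by rewrite addSn -addnS prednK // addnC divnDl ?dvdnn // divnn s0 divn_small ?addn0 // ltnW.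
by rewrite evXn_X1n; congr ('C(_, _)%:R); lia.
Qed.

End Families.


(** * Elimination of leaves *)

Section TreeSum.
Variables (R : rcfType) (T : finType) (root : T) (parent : T -> T) (height : T -> nat).
Variables (s : T -> nat) (strict_edge : T -> bool).
Hypothesis s_gt0 : forall v, (0 < s v)%N.
Hypothesis height_lt : forall v, v != root -> (height v < height (parent v))%N.
Implicit Types (A : {set T}) (c v : T) (W : T -> nat -> R) (D : T -> nat) (m n N : nat).

Definition edge_ok c m m' : bool :=
  if strict_edge c then (m * s (parent c) < m' * s c)%N
  else (m * s (parent c) <= m' * s c)%N.

(** Coordinates outside [A] are pinned to 0, so deleted vertices do not multiply the points; [N] is
    only a common bound that makes the type of labelings finite. *)
Definition admissible N A n (x : {ffun T -> 'I_N.+1}) : bool :=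
  [forall v, if v \in A then (x v <= n * s v)%N &&
               ((v != root) ==> edge_ok v (x v) (x (parent v)))
             else x v == ord0].

Definition tree_sum N A W n : R :=
  \sum_(x : {ffun T -> 'I_N.+1} | admissible A n x) \prod_(v in A) W v (x v).

(** The number of values allowed at [c] when its parent has value [m]: a ceiling for a strict edge,
    a floor plus one for a weak edge. *)
Definition cut c m : nat :=
  if strict_edge c then ((m * s c + (s (parent c)).-1) %/ s (parent c))%N
  else (m * s c %/ s (parent c)).+1.

Lemma edge_ok_cut c m m' : edge_ok c m m' = (m < cut c m')%N.
Proof.
rewrite /edge_ok /cut; have := s_gt0 (parent c).
case: ifP => _ p0; last by rewrite ltnS leq_divRL.
by rewrite leq_divRL // mulSn; lia.
Qed.

Lemma cut_period c n j : cut c (n * s (parent c) + j) = (n * s c + cut c j)%N.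
Proof.
rewrite /cut mulnDl mulnAC; case: ifP => _; first by rewrite -addnA divnMDl.
by rewrite divnMDl // addnS.
Qed.

(** The upper bound at the child is thus implied by the one at its parent, and the sum over a leaf
    runs over a full prefix. *)
Lemma cut_le c m n : (m <= n * s (parent c))%N -> (cut c m <= (n * s c).+1)%N.
Proof.
move=> mn; have p0 := s_gt0 (parent c); have c0 := s_gt0 c.
have h : (m * s c <= n * s c * s (parent c))%N by rewrite mulnAC leq_mul2r mn orbT.
rewrite /cut; case: ifP => _; last by rewrite ltnS -(mulnK (n * s c) p0) leq_div2r.
by rewrite -ltnS ltn_divLR // !mulSn; lia.
Qed.

Lemma cut_lt c j : (j < s (parent c))%N -> (cut c j <= s c)%N.
Proof.
move=> js; have p0 := s_gt0 (parent c); have c0 := s_gt0 c.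
have h : (j * s c < s c * s (parent c))%N by rewrite mulnC ltn_mul2l c0.
rewrite /cut; case: ifP => _; last by rewrite ltn_divLR.
by rewrite -ltnS ltn_divLR // mulSn; lia.
Qed.

Lemma cut_mono c j k : (j <= k)%N -> (cut c j <= cut c k)%N.
Proof.
move=> jk; rewrite /cut; case: ifP => _.
  by rewrite leq_div2r // leq_add2r leq_mul2r jk orbT.
by rewrite ltnS leq_div2r // leq_mul2r jk orbT.
Qed.

Definition update N (x : {ffun T -> 'I_N.+1}) c (m : 'I_N.+1) : {ffun T -> 'I_N.+1} :=
  [ffun v => if v == c then m else x v].

Definition absorb W c : T -> nat -> R := fun v m =>
  if v == parent c then W v m * \sum_(i < cut c m) W c i else W v m.

Section Leaf.
Variables (A : {set T}) (c : T).
Hypothesis cA : c \in A.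
Hypothesis c_root : c != root.
Hypothesis leaf : forall v, v \in A -> v != root -> parent v != c.
Hypothesis pA : parent c \in A.

Lemma parent_neq : parent c != c.
Proof. by apply: contraTneq (height_lt c_root) => ->; rewrite ltnn. Qed.

Lemma admissible_update N n (y : {ffun T -> 'I_N.+1}) (m : 'I_N.+1) : admissible (A :\ c) n y ->
  admissible A n (update y c m) = (m < cut c (y (parent c)))%N.
Proof.
move=> /forallP ady; have ync : (y (parent c) <= n * s (parent c))%N.
  by have := ady (parent c); rewrite !inE parent_neq pA => /andP[].
apply/forallP/idP => [/(_ c)|mc v].
  rewrite cA c_root /= !ffunE eqxx (negPf parent_neq) edge_ok_cut => /andP[_].
  by [].
have := ady v; rewrite !inE !ffunE; have [->|vc] /= := eqVneq v c.
  rewrite cA c_root /= (negPf parent_neq) edge_ok_cut mc andbT.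
  by rewrite -ltnS (leq_trans mc) ?cut_le.
case: ifP => // vA /andP[-> /=]; case: (eqVneq v root) => //= vr.
by rewrite (negPf (leaf vA vr)).
Qed.

Lemma tree_sum_leaf N W n : (forall v, n * s v <= N)%N ->
  tree_sum N A W n = tree_sum N (A :\ c) (absorb W c) n.
Proof.
move=> nN; rewrite /tree_sum.
(* The labelings are grouped by their restriction to the other vertices, then each group is
   parametrised by the value at [c]. *)
rewrite (partition_big (fun x => update x c ord0) (admissible (A :\ c) n)) /=; last first.
  move=> x /forallP adx; apply/forallP => v; have := adx v; rewrite !inE !ffunE.
  have [->|vc] /= := eqVneq v c; first by [].
  case: ifP => // vA /andP[-> /=]; case: (eqVneq v root) => //= vr.
  by rewrite (negPf (leaf vA vr)).
apply: eq_bigr => y ady; have yc : y c = ord0.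
  by have /forallP/(_ c) := ady; rewrite !inE eqxx /= => /eqP.
rewrite (reindex_onto (fun m : 'I_N.+1 => update y c m) (fun x : {ffun T -> 'I_N.+1} => x c)) /=; last first.
  move=> x /andP[_ /eqP <-]; apply/ffunP => v; rewrite !ffunE.
  by case: eqP => [->|].
have ycut : (cut c (y (parent c)) <= N.+1)%N.
  have /forallP/(_ (parent c)) := ady; rewrite !inE parent_neq pA => /andP[h _].
  by rewrite (leq_trans (cut_le h)) ?ltnS.
transitivity (\sum_(m < N.+1 | (m < cut c (y (parent c)))%N) W c m * \prod_(v in A :\ c) W v (y v)).
  apply: eq_big => [m|m _].
    rewrite admissible_update // ffunE !eqxx andbT.
    have -> : update (update y c m) c ord0 == y; last by rewrite andbT.
    by apply/eqP/ffunP => v; rewrite !ffunE; case: eqP => // ->.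
  rewrite (big_setD1 c) //= ffunE eqxx; congr (_ * _); apply: eq_bigr => v.
  by rewrite !inE ffunE => /andP[/negPf->].
rewrite -mulr_suml -(big_ord_widen _ (fun m => W c m) ycut).
have pA' : parent c \in A :\ c by rewrite !inE parent_neq.
rewrite !(big_setD1 _ pA') /= [absorb W c (parent c) _]/absorb eqxx mulrA [_ * W _ _]mulrC; congr (_ * _).
by apply: eq_bigr => v; rewrite !inE /absorb => /andP[/negPf->].
Qed.

End Leaf.

(** Removing a leaf [c] raises the degree at its parent by [D c + 1] and lowers [#|A|] by one, so
    the total degree is invariant. *)
Lemma tree_sum_good A W D : root \in A ->
  (forall v, v \in A -> v != root -> parent v \in A) ->
  (forall v, interlacing_family (s v) (D v) (W v)) ->
  exists2 Phi, good (\sum_(v in A) D v + #|A|) Phi &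
    forall n N, (forall v, n * s v <= N)%N -> tree_sum N A W n = ev Phi n.
Proof.
move: {2}#|A| (leqnn #|A|) => k; elim: k A W D => [|k IH] A W D.
  by rewrite leqn0 cards_eq0 => /eqP->; rewrite inE.
move=> Ak rA clA famW; have [|[c0]] := set_0Vmem (A :\ root).
  move=> A0; have {A0}-> : A = [set root].
    by apply/setP => v; rewrite inE; have /setP/(_ v) := A0; rewrite !inE; case: eqP => [->|].
  have [Phi [gP iP eP]] := famW root.
  exists (prefix_poly (s root) Phi 1).
    (* The index 1 appears because the values 0, ..., n s(root) form a prefix of length n s(root) +
       1. *)
    by rewrite big_set1 cards1 addn1; apply: good_prefix.
  move=> n N nN; rewrite -(ev_prefix (W := W root)) // /tree_sum addn1.
  rewrite (reindex_onto (fun m : 'I_N.+1 => update [ffun=> ord0] root m) (fun x : {ffun T -> 'I_N.+1} => x root)).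
    have nr : ((n * s root).+1 <= N.+1)%N by rewrite ltnS.
    rewrite (big_ord_widen _ (fun m => W root m) nr) /=; apply: eq_big => m; last first.
      by rewrite big_set1 ffunE eqxx.
    rewrite ffunE !eqxx andbT ltnS; apply/forallP/idP => [/(_ root)|mn v].
      by rewrite inE !ffunE !eqxx andbT.
    by rewrite inE !ffunE; have [->|vr] := eqVneq v root; rewrite ?mn ?eqxx.
  move=> x /forallP adx; apply/ffunP => v; rewrite !ffunE; have := adx v; rewrite inE.
  by case: eqP => [->|_ /eqP->].
rewrite !inE => /andP[c0r c0A].
(* A vertex of least height among the non-root vertices of [A] has no child in [A]. *)
have [|c /andP[cr cA] cmin] := @arg_minnP _ c0 (fun v => (v != root) && (v \in A)) height.
  by rewrite c0r.
have leaf v : v \in A -> v != root -> parent v != c.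
  move=> vA vr; apply: contraTneq (cmin v _) => [pv|]; last by rewrite vr.
  by rewrite -ltnNge -pv height_lt.
have pA := clA _ cA cr.
pose D' v := if v == parent c then (D v + (D c).+1)%N else D v.
have [||||Phi gP eP] := IH (A :\ c) (absorb W c) D'.
- by move: Ak; rewrite (cardsD1 c) cA.
- by rewrite !inE eq_sym cr.
- by move=> v; rewrite !inE => /andP[vc vA] vr; rewrite leaf //= clA.
- move=> v; rewrite /D' /absorb; case: (eqVneq v (parent c)) => [->|_] //.
  apply: family_mul => //; apply: (family_cut (cut := cut c) (kappa := cut c)) (s_gt0 c) (famW c) _ _ _.
  + by move=> n j _; apply: cut_period.
  + by move=> j; apply: cut_lt.
  by move=> j j'; apply: cut_mono.
exists Phi; last by move=> n N nN; rewrite (tree_sum_leaf cA cr leaf pA) // eP.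
have -> // : (\sum_(v in A) D v + #|A| = \sum_(v in A :\ c) D' v + #|A :\ c|)%N.
rewrite (big_setD1 c) //= (cardsD1 c) cA.
have pA' : parent c \in A :\ c by rewrite !inE (parent_neq cr).
rewrite !(big_setD1 _ pA') /= [D' (parent c)]/D' eqxx.
have -> : (\sum_(i in A :\ c :\ parent c) D' i = \sum_(i in A :\ c :\ parent c) D i)%N.
  by apply: eq_bigr => v; rewrite !inE /D' => /andP[/negPf->].
lia.
Qed.

End TreeSum.


(** * The h-star polynomial and the lattice sum *)

Section Hstar.
Variable R : realType.
Implicit Types (p f : {poly R}) (c : nat -> R).

(** Multiplying a generating function by 1 - X amounts to replacing the sequence by its backward
    difference [c']. *)
Lemma conv_one_sub_X p c c' k : c' 0%N = c 0%N -> (forall i, c' i.+1 = c i.+1 - c i) ->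
  \sum_(j < k.+1) (p * (1 - 'X))`_j * c (k - j)%N = \sum_(j < k.+1) p`_j * c' (k - j)%N.
Proof.
move=> c0 cS; pose Q b := \poly_(i < k.+1) (b i : R).
have E (q : {poly R}) b : \sum_(j < k.+1) q`_j * b (k - j)%N = (q * Q b)`_k.
  by rewrite coefM; apply: eq_bigr => j _; rewrite coef_poly ltnS leq_subr.
rewrite !E -mulrA !coefM; apply: eq_bigr => j _; congr (_ * _).
rewrite mulrBl mul1r coefB coefXM.
case: (k - j)%N (leq_subr j k) => [|i] ik; rewrite !coef_poly !ltnS ?ik /= ?subr0 ?c0 //.
by rewrite (ltnW (ik : (i < k)%N)) cS.
Qed.

(** Coefficient form of the expansion of 1 / (1 - t)^(a + 1), whose n-th coefficient is C(n + a,
    a). *)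
Lemma conv_bin p a k :
  \sum_(j < k.+1) (p * (1 - 'X) ^+ a.+1)`_j * 'C(k - j + a, a)%:R = p`_k.
Proof.
elim: a p => [|a IH] p.
  rewrite expr1 (@conv_one_sub_X _ (fun i => 'C(i + 0, 0)%:R) (fun i => (i == 0%N)%:R)).
  - rewrite big_ord_recr /= subnn mulr1 big1 ?add0r // => j _.
    by rewrite subn_eq0 leqNgt ltn_ord mulr0.
  - by rewrite bin0.
  by move=> i; rewrite !bin0 subrr.
rewrite exprSr mulrA (@conv_one_sub_X _ (fun i => 'C(i + a.+1, a.+1)%:R) (fun i => 'C(i + a, a)%:R)).
- exact: IH.
- by rewrite !add0n !binn.
by move=> i; rewrite [in RHS]addSn binS natrD addrAC subrr add0r addSnnS.
Qed.

Lemma good_root_real D f s : good D f -> cval s f = 0 -> complex.Im s = 0.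
Proof.
move=> gf fs; have [h|h|//] := ltgtP (complex.Im s) 0.
  have : 0 < complex.Im (conjc s) by case: (s) h => a b /=; rewrite oppr_gt0.
  by move/(good_neq0 gf); rewrite cval_conj fs conjc0 eqxx.
by have := good_neq0 gf h; rewrite fs eqxx.
Qed.

(* The change of variables x = 1 / (1 - t) preserves the real line. *)
Lemma hstar_of_good d P s (w : 'rV[R]_d -> R) D f : good D f ->
  (forall n, weighted_ehrhart P s w n = ev f n) ->
  exists h : {poly R}, is_weighted_hstar P s w D h /\ real_rooted h.
Proof.
move=> gf ehr; have sf := good_size gf.
(* The term [a] contributes f_a / (1 - t)^(a + 1), which becomes f_a (1 - t)^(D - a) over the common
   denominator. *)
exists (\sum_(a < D.+1) f`_a *: (1 - 'X) ^+ (D - a)); split.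
  move=> k; rewrite coef_sum.
  transitivity (\sum_(j < k.+1) \sum_(a < D.+1) ((1 - 'X) ^+ D.+1 : {poly R})`_j *
      (f`_a * 'C(k - j + a, a)%:R)).
    by apply: eq_bigr => j _; rewrite ehr /ev sf mulr_sumr.
  rewrite exchange_big; apply: eq_bigr => -[a /= aD] _.
  rewrite coefZ -(conv_bin _ a) mulr_sumr; apply: eq_bigr => j _.
  by rewrite -exprD addnS subnK // mulrCA.
move=> z; rewrite rootE -/(cval z _) => /eqP hz.
(* The substitution 1 / (1 - z) is undefined at z = 1, which is real anyway. *)
have [z1|z1] := eqVneq (1 - z) 0.
  by have -> : z = 1 by apply/eqP; rewrite eq_sym -subr_eq0 z1.
have : cval (1 - z)^-1 f = 0.
  apply: (mulfI (expf_neq0 D z1)); rewrite mulr0 -hz cval_sum /cval horner_coef.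
  rewrite size_map_poly sf mulr_sumr; apply: eq_bigr => -[a /= aD] _.
  rewrite coef_map /= -/(cval z _) cvalZ cvalXn; have -> : cval z (1 - 'X) = 1 - z.
    by rewrite -opprB -scaleN1r cvalZ cvalX1 rmorphN1 mulN1r opprB.
  rewrite mulrCA exprVn; congr (_ * _).
  by rewrite -{1}(subnK (aD : (a <= D)%N)) exprD mulfK // expf_neq0.
move/(good_root_real gf); set y := _^-1 => y0.
have zE : z = 1 - y^-1 by rewrite /y invrK opprB addrCA subrr addr0.
have yE : y = real_complex R (complex.Re y) by case: (y) y0 => a b /= ->.
by rewrite zE yE rpredB ?rpred1 // rpredV; apply/complex_realP; eexists.
Qed.

End Hstar.

(** * Parents and heights in a rooted tree *)

Section Tree.
Variables (d : nat) (P : rel 'I_d).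

Lemma rooted_tree_parent : rooted_tree P -> exists (root : 'I_d) (parent : 'I_d -> 'I_d)
    (height : 'I_d -> nat),
  [/\ forall v, v != root -> strict P v (parent v) /\ (height v < height (parent v))%N,
      forall v, (height v <= d)%N
    & forall i j, strict P i j -> i != root /\ (parent i = j \/ strict P (parent i) j)].
Proof.
move=> [[Prefl Panti Ptrans] [r [[rmax _] cov]]].
(* A total parent function is chosen; its value at the root is arbitrary. *)
have /choice[parent hp] : forall i, exists j,
    i != r -> unique (fun j => covered_by P i j) j.
  move=> i; have [->|ir] := eqVneq i r; first by exists r.
  by have [j hj] := cov i ir; exists j.
pose height v := #|[set k | P k v]|.
have hlt i j : strict P i j -> (height i < height j)%N.
  move=> /andP[ij Pij]; apply: proper_card; apply/properP; split.
    by apply/fintype.subsetP => k; rewrite !inE => Pki; apply: Ptrans Pij.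
  exists j; rewrite inE ?Prefl //; apply/negP => Pji.
  by case/eqP: ij; apply: Panti; rewrite Pij.
exists r, parent, height; split.
- move=> v vr; have [/andP[st _] _] := hp v vr; split=> //; exact: hlt.
- by move=> v; rewrite -[X in (_ <= X)%N]card_ord; apply: max_card.
move=> i j ij; have ir : i != r by apply: contraTneq ij => ->; exact: rmax.
(* An element of least height among those strictly above [i] and at most [j] covers [i], hence is
   the parent of [i]. *)
split=> //; have [|k /andP[ik Pkj] kmin] := @arg_minnP _ j (fun k => strict P i k && P k j) height.
  by rewrite ij Prefl.
have ck : covered_by P i k.
  rewrite /covered_by ik; apply/forallP => m; apply/negP => /andP[im mk].
  have /andP[_ Pmk] := mk.
  by have := kmin m; rewrite im (Ptrans _ _ _ Pmk Pkj) leqNgt hlt // => /(_ isT).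
have [_ /(_ k ck) ->] := hp i ir; case: (eqVneq k j) => [->|kj]; first by left.
by right; rewrite /strict kj.
Qed.

End Tree.


(** * Lattice points as admissible labelings of the tree *)

Section LatticeSum.
Variables (R : realType) (d : nat) (P : rel 'I_d) (s : 'I_d -> nat).
Hypothesis s_gt0 : forall i, (0 < s i)%N.
Implicit Types (x : 'I_d -> nat) (b : nat).

Definition nat_row x : 'rV[R]_d := \row_i (x i)%:R.

Lemma ratio_nat_row x i : Defs.ratio s (nat_row x) i = (x i)%:R / (s i)%:R.
Proof. by rewrite /Defs.ratio /nat_row mxE. Qed.

Lemma ler_ratio x i j : (Defs.ratio s (nat_row x) i <= Defs.ratio s (nat_row x) j) =
  (x i * s j <= x j * s i)%N.
Proof.
rewrite !ratio_nat_row ler_pdivrMr ?ltr0n // mulrAC ler_pdivlMr ?ltr0n //.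
by rewrite -!natrM ler_nat.
Qed.

Lemma ltr_ratio x i j : (Defs.ratio s (nat_row x) i < Defs.ratio s (nat_row x) j) =
  (x i * s j < x j * s i)%N.
Proof. by rewrite !ltNge ler_ratio -ltnNge. Qed.

Lemma real_binomial_nat n b : real_binomial (n%:R : R) b = 'C(n, b)%:R.
Proof.
have f0 : b`!%:R != 0 :> R by rewrite pnatr_eq0 -lt0n fact_gt0.
apply: (mulIf f0); rewrite /real_binomial divfK // -natrM bin_ffact => {f0}.
elim: b => [|b IH]; first by rewrite big_ord0.
rewrite big_ord_recr /= IH ffactnSr natrM; have [bn|nb] := leqP b n; first by rewrite natrB.
by rewrite ffact_small // !mul0r.
Qed.

(** At a point with natural coordinates the real binomial is an ordinary one, and floor and ceiling
    become natural divisions, the ceiling after adding s - 1. *)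
Lemma weight_factor_family (w : 'rV[R]_d -> R) b : weight_factor s w b ->
  exists k W, interlacing_family (s k) b W /\ forall x, w (nat_row x) = W (x k).
Proof.
move=> [k [a hw]]; exists k; have k0 : 0 < (s k)%:R :> R by rewrite ltr0n.
case: hw => [[ab ->]|[/andP[_ ab] ->]|[ab ->]].
- exists (fun m => 'C(m + a, b)%:R); split.
    by rewrite -(subnKC ab); apply: family_bin.
  by move=> x; rewrite /nat_row mxE -natrD real_binomial_nat.
- exists (fun m => 'C(m %/ s k + a, b)%:R); split.
    by rewrite -(subnKC ab); apply: family_floor.
  move=> x; have -> : Num.floor (Defs.ratio s (nat_row x) k) = (x k %/ s k)%N.
    apply: floor_def; rewrite ratio_nat_row -PoszD -!pmulrn.
    rewrite ler_pdivlMr // ltr_pdivrMr // -!natrM ler_nat ltr_nat leq_trunc_div /=.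
    by rewrite addn1 ltn_ceil.
  by rewrite -pmulrn -natrD real_binomial_nat.
exists (fun m => 'C((m + (s k).-1) %/ s k + a, b)%:R); split.
  have -> : b = (a + (b - a.+1).+1)%N by lia.
  exact: family_ceil.
move=> x; set c := ((x k + (s k).-1) %/ s k)%N.
have -> : Num.ceil (Defs.ratio s (nat_row x) k) = c.
  have sk := s_gt0 k; apply: ceil_def.
  rewrite ratio_nat_row rmorphB /= rmorph1 -pmulrn.
  rewrite ltrBlDr ler_pdivrMr // -natrM ler_nat -[X in _ + X](divff (lt0r_neq0 k0)) -mulrDl.
  rewrite ltr_pdivlMr // -natrM -natrD ltr_nat.
  have := leq_trunc_div (x k + (s k).-1) (s k); have := ltn_ceil (x k + (s k).-1) sk.
  by rewrite -/c mulSn; lia.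
by rewrite -pmulrn -natrD real_binomial_nat.
Qed.

Variables (root : 'I_d) (parent : 'I_d -> 'I_d) (height : 'I_d -> nat).
Hypothesis heightP : forall v, v != root ->
  strict P v (parent v) /\ (height v < height (parent v))%N.
Hypothesis height_le : forall v, (height v <= d)%N.
Hypothesis parentP : forall i j, strict P i j ->
  i != root /\ (parent i = j \/ strict P (parent i) j).

Definition label_descent (v : 'I_d) : bool := (parent v < v)%N.

(** Weak inequalities compose along the chain of parents. If j < i as labels, either the first edge
    is a descent and already strict, or j < i <= [parent i] as labels and strictness comes from the
    rest of the chain. *)
Lemma is_partition_edges x : is_partition P s (nat_row x) <->
  forall v, v != root -> edge_ok parent s label_descent v (x v) (x (parent v)).
Proof.
rewrite /edge_ok; split=> [hx v vr|hx i j].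
  have [st _] := heightP vr; have [le lt] := hx _ _ st.
  by rewrite /label_descent; case: ifP => [/lt|_]; rewrite -?ltr_ratio -?ler_ratio.
have [n] := ubnP (d - height i); elim: n i => // n IH i hn ij.
have [ir [pj|pj]] := parentP ij.
  have := hx i ir; rewrite /label_descent pj ler_ratio ltr_ratio.
  by case: ifP => [ji lt|]; [rewrite ltnW|].
have [[/andP[ip _] hlt] hi] := (heightP ir, hx i ir).
have [|le lt] := IH (parent i) _ pj; first by have := height_le (parent i); lia.
move: hi; rewrite /label_descent; case: ltnP => [pi|ile].
  rewrite -ltr_ratio => hlt'; have hlt2 := lt_le_trans hlt' le.
  by split=> [|_]; first exact: ltW.
rewrite -ler_ratio => hle; split=> [|ji]; first exact: le_trans hle le.
apply: le_lt_trans hle (lt _); apply: leq_trans ji _.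
by [].
Qed.

(** Lattice points of the dilate have natural coordinates bounded by n s(v), so they are the images
    of the admissible functions under [h]. *)
Lemma weighted_ehrhart_tree_sum (w : 'rV[R]_d -> R) (W : 'I_d -> nat -> R) n N :
  (forall x, w (nat_row x) = \prod_v W v (x v)) -> (forall v, n * s v <= N)%N ->
  weighted_ehrhart P s w n = tree_sum root parent s label_descent N [set: 'I_d] W n.
Proof.
move=> wE nN; pose adm := admissible root parent s label_descent [set: 'I_d] n (N := N).
pose h (f : {ffun 'I_d -> 'I_N.+1}) := nat_row (fun i => f i).
have admP (f : {ffun 'I_d -> 'I_N.+1}) : reflect (forall v, (f v <= n * s v)%N /\
    (v != root -> edge_ok parent s label_descent v (f v) (f (parent v)))) (adm f).
  apply: (iffP forallP) => hf v; have := hf v; rewrite finset.in_setT.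
    by move=> /andP[-> /implyP].
  by move=> [-> /implyP].
rewrite /weighted_ehrhart (reindex_fsbig h [set` enum adm]); last first.
  split=> [f|f g _ _ fg|x [[xP xn] xZ]].
  - rewrite /= mem_enum => /admP hf; split; last first.
      by move=> i; rewrite /h /nat_row mxE natr_int.
    split; first by apply/is_partition_edges => v; apply: (hf v).2.
    move=> i; rewrite /h ratio_nat_row divr_ge0 //= ler_pdivrMr ?ltr0n //.
    by rewrite -natrM ler_nat (hf i).1.
  - apply/ffunP => i; apply/val_inj/eqP; rewrite -(eqr_nat R).
    by move/rowP/(_ i): fg; rewrite /h /nat_row !mxE => ->.
  have /choice[g gE] i : exists k : 'I_N.+1, x 0 i = (k : nat)%:R.
    have si : 0 < (s i)%:R :> R by rewrite ltr0n.
    have := xn i; rewrite /Defs.ratio pmulr_lge0 ?invr_gt0 // => /andP[x0 xle].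
    have /natrP[k xE] : x 0 i \is a Num.nat by rewrite natrEint xZ x0.
    move: xle; rewrite xE ler_pdivrMr // -natrM ler_nat => kn.
    by exists (Ordinal (leq_trans kn (nN i) : (k < N.+1)%N)).
  have hx : h (finfun g) = x by apply/rowP => i; rewrite /h /nat_row mxE ffunE gE.
  exists (finfun g) => //=; rewrite mem_enum; apply/admP => v; split.
    have := xn v; rewrite -hx /h ratio_nat_row ler_pdivrMr ?ltr0n // -natrM ler_nat.
    by case/andP.
  by move: v; apply/is_partition_edges; rewrite -/(h _) hx.
rewrite -fsbig_seq ?enum_uniq // big_enum /tree_sum; apply: eq_bigr => f _.
by rewrite /h wE; apply: eq_bigl => v; rewrite finset.in_setT.
Qed.

End LatticeSum.

Theorem corollary1p3 (R : realType) (d : nat) (hd : (0 < d)%N)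
    (P : rel 'I_d) (hP : rooted_tree P)
    (s : 'I_d -> nat) (hs : forall i, (0 < s i)%N)
    (l : nat) (w : 'I_l -> 'rV[R]_d -> R) (b : 'I_l -> nat)
    (hw : forall i, weight_factor s (w i) (b i)) :
  exists h : {poly R},
    is_weighted_hstar P s (fun x => \prod_(i < l) w i x)
                      (d + \sum_(i < l) b i)%N h
    /\ real_rooted h.
Proof.
have [root [parent [height [hh hle hpar]]]] := rooted_tree_parent hP.
have /choice[k hk] : forall i, exists k W,
    interlacing_family (s k) (b i) W /\ forall x, w i (nat_row R x) = W (x k).
  by move=> i; apply: weight_factor_family.
have {hk} /choice[V hV] := hk.
(* Weight factors are collected by the vertex they depend on; a vertex with none gets the constant 1
   and degree 0. *)
pose W v m := \prod_(i < l | k i == v) V i m.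
pose D v := (\sum_(i < l | k i == v) b i)%N.
have famW v : interlacing_family (s v) (D v) (W v).
  by apply: family_prod => i /eqP <-; have [] := hV i.
have [||Phi gP eP] := @tree_sum_good _ _ root parent height s (label_descent parent) hs
  (fun v vr => (hh v vr).2) [set: 'I_d] W D _ _ famW.
- by rewrite finset.in_setT.
- by move=> v _ _; rewrite finset.in_setT.
have wE x : \prod_(i < l) w i (nat_row R x) = \prod_v W v (x v).
  rewrite (partition_big k xpredT) //=; apply: eq_bigr => v _.
  by apply: eq_bigr => i /eqP <-; have [_ ->] := hV i.
apply: (hstar_of_good (f := Phi)).
  have -> // : (d + \sum_(i < l) b i = \sum_(v in [set: 'I_d]) D v + #|[set: 'I_d]|)%N.
  rewrite cardsT card_ord addnC (partition_big k xpredT) //=; congr (_ + _)%N.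
  by apply: eq_bigl => v; rewrite finset.in_setT.
move=> n; pose N := (\max_v n * s v)%N.
have nN v : (n * s v <= N)%N by apply: (leq_bigmax (F := fun v => n * s v)%N).
by rewrite (weighted_ehrhart_tree_sum hs hh hle hpar wE nN) eP.
Qed.
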